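(* Let $\mathcal{H}$ be a toric hyperplane arrangement on the torus $T^n=\mathbb{R}^n/\mathbb{Z}^n$ that subdivides the torus into open $n$-dimensional balls, and let $\mathcal{P}$ be its intersection poset. Then the number of regions of the complement of $\mathcal{H}$ equals $Z_t(\mathcal{P})$.
   Context: A toric hyperplane is the image under $\mathbb{R}^n\to\mathbb{R}^n/\mathbb{Z}^n$ of a hyperplane $\{\vec x:\vec a\cdot\vec x=b\}$ with $\vec a\in\mathbb{Q}^n\setminus\{0\}$, $b\in\mathbb{R}$; a toric arrangement is a finite collection $\{H_1,\dots,H_m\}$ of them. The intersection poset $\mathcal{P}$ consists of all connected components of all intersections $\bigcap_{i\in S}H_i$ (the empty intersection being $T^n$), together with $\emptyset$, ordered by reverse inclusion; its minimum $\hat0$ is $T^n$ and maximum $\hat1$ is $\emptyset$. Ranks: $\rho(x)=n-\dim x$ for nonempty $x$, and $\rho(\emptyset)=n+1$. For such a poset, $Z_t(\mathcal{P})=\sum_{x}(-1)^{\rho(x)}\mu(\hat0,x)$, the sum over all coatoms $x$ of $\mathcal{P}$ (elements covered by $\hat1$), where $\mu$ is the Möbius function. *)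

(* Defs.v *)
From HB Require Import structures.
From mathcomp Require Import all_boot all_order all_algebra finmap.
From mathcomp Require Import generic_quotient.
From mathcomp Require Import all_classical all_reals all_analysis.

Set Implicit Arguments.
Unset Strict Implicit.
Unset Printing Implicit Defensive.

Import Order.TTheory GRing.Theory Num.Theory.
Import numFieldNormedType.Exports.

Local Open Scope classical_set_scope.
Local Open Scope ring_scope.

Section FinitePoset.
Context {d : Order.disp_t} {U : porderType d} (P : {fset U}).
Implicit Types x y z : U.

(* A chain in P has at most #|` P | elements, so #|` P | steps of the
   recursion reach its fixed point: see [mobiusE]. *)
Fixpoint mobius_rec (k : nat) (x y : U) : int :=
  if x == y then 1 else
  if k is k'.+1 then
    - \sum_(z <- P | ((x <= z) && (z < y))%O) mobius_rec k' x z
  else 0.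

Definition mobius : U -> U -> int := mobius_rec #|` P |.

Definition covered_in (x y : U) : bool :=
  [&& x \in P, y \in P, (x < y)%O &
      all (fun z => ~~ ((x < z) && (z < y))%O) (enum_fset P)].

Let below (y : U) : nat := #|` [fset z in P | (z < y)%O]%fset |.

Let below_lt z y : z \in P -> (z < y)%O -> (below z < below y)%N.
Proof.
move=> zP zy; apply: fproper_ltn_card; rewrite fproperE.
apply/andP; split; [apply/fsubsetP => w | apply/negP => /fsubsetP/(_ z)].
  by rewrite !inE /= => /andP[-> wz]; exact: lt_trans wz zy.
by rewrite !inE /= zP zy ltxx => /(_ isT).
Qed.

Let mobius_rec_stable k k' x y :
  (below y < k)%N -> (below y < k')%N -> mobius_rec k x y = mobius_rec k' x y.
Proof.
elim: k k' y => // k IH [//|k'] y yk yk' /=.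
case: ifP => // _; apply: congr1.
rewrite big_seq_cond [RHS]big_seq_cond; apply: eq_bigr => z.
move=> /andP[zP /andP[_ zy]]; have lt := below_lt zP zy.
by apply: IH; apply: leq_trans lt _.
Qed.

Let below_max y : y \in P -> (below y < #|` P |)%N.
Proof.
move=> yP; apply: fproper_ltn_card; rewrite fproperE.
apply/andP; split; [apply/fsubsetP => w | apply/negP => /fsubsetP/(_ y yP)].
  by rewrite !inE /= => /andP[].
by rewrite !inE /= ltxx andbF.
Qed.

Lemma mobiusE x y : y \in P ->
  mobius x y = if x == y then 1
               else - \sum_(z <- P | ((x <= z) && (z < y))%O) mobius x z.
Proof.
move=> yP; rewrite /mobius.
rewrite -(@mobius_rec_stable #|` P |.+1 #|` P | x y) /=; last exact: below_max.
  by case: eqP => //.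
by rewrite ltnS ltnW // below_max.
Qed.

Lemma mobius_refl x : mobius x x = 1.
Proof. by rewrite /mobius; case: #|` P | => [|k] /=; rewrite eqxx. Qed.

Lemma mobius_sum x y : y \in P -> (x < y)%O ->
  \sum_(z <- P | ((x <= z) && (z <= y))%O) mobius x z = 0.
Proof.
move=> yP xy; rewrite big_mkcond (bigD1_seq y) ?fset_uniq //=.
rewrite lexx ltW //= -big_mkcondr (mobiusE x yP) lt_eqF // addrC.
apply/eqP; rewrite subr_eq0; apply/eqP; apply: eq_bigl => z.
by rewrite lt_neqAle andbCA.
Qed.

End FinitePoset.

Section Torus.
Context (R : realType) (n : nat).

Definition lattice_equiv (x y : 'rV[R]_n) : bool :=
  [forall i, x ord0 i - y ord0 i \is a Num.int].

Lemma lattice_equiv_refl : reflexive lattice_equiv.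
Proof. by move=> x; apply/forallP => i; rewrite subrr rpred0. Qed.

Lemma lattice_equiv_sym : symmetric lattice_equiv.
Proof.
by move=> x y; apply: eq_forallb => i; rewrite -opprB rpredN.
Qed.

Lemma lattice_equiv_trans : transitive lattice_equiv.
Proof.
move=> y x z /forallP xy /forallP yz; apply/forallP => i.
by rewrite -(subrKA (y ord0 i)) rpredD.
Qed.

Canonical lattice_equivRel :=
  EquivRel lattice_equiv lattice_equiv_refl lattice_equiv_sym
           lattice_equiv_trans.

Definition torus := quotient_topology {eq_quot lattice_equivRel}%qT.
HB.instance Definition _ := Topological.on torus.
HB.instance Definition _ := Quotient.on torus.

Definition torus_proj (x : 'rV[R]_n) : torus := (\pi_torus x)%qT.

Definition toric_hyperplane (X : set torus) : Prop :=
  exists (a : 'rV[rat]_n) (b : R), a != 0 /\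
    X = torus_proj @`
          [set x : 'rV[R]_n | \sum_(i < n) ratr (a ord0 i) * x ord0 i = b].

Definition component_of (A X : set torus) : Prop :=
  exists2 x, A x & X = connected_component A x.

Definition open_unit_ball : set 'rV[R]_n :=
  [set x | \sum_(i < n) x ord0 i ^+ 2 < 1].

Definition open_cell (X : set torus) : Prop :=
  exists (f : torus -> 'rV[R]_n) (g : 'rV[R]_n -> torus),
    [/\ {within X, continuous f}, {within open_unit_ball, continuous g},
        f @` X `<=` open_unit_ball, g @` open_unit_ball `<=` X &
        {in X, cancel f g} /\ {in open_unit_ball, cancel g f}].

(* X is the image of a k-dimensional affine subspace of R^n.  Such a k is
   unique: if p + V + Z^n = q + W + Z^n then V is covered by countably many
   translates of W, whence V is included in W, and conversely. *)
Definition has_toric_dim (X : set torus) (k : nat) : Prop :=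
  exists (p : 'rV[R]_n) (V : 'M[R]_(k, n)), row_free V /\
    X = torus_proj @` [set x | exists u : 'rV[R]_k, x = p + u *m V].

(* Only meaningful when X is a nonempty toric subspace. *)
Definition toric_dim (X : set torus) : nat := xget 0%N (has_toric_dim X).

Definition toric_rank (X : set torus) : nat :=
  if X == set0 then n.+1 else (n - toric_dim X)%N.

Section Arrangement.
Context (m : nat) (H : 'I_m -> set torus).

Definition regions : set (set torus) :=
  [set X | component_of (~` \bigcup_i H i) X].

Definition flats : set (set torus) :=
  [set X | X = set0 \/
     exists S : {set 'I_m}, component_of (\bigcap_(i in [set` S]) H i) X].

(* [flats] is finite when every H i is a toric hyperplane, and then
   [fset_set flats] has the same elements. *)
Definition intersection_poset : {fset (set torus)^d} := fset_set flats.

Definition Zt : int :=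
  \sum_(X <- intersection_poset | covered_in intersection_poset X set0)
     (-1) ^+ toric_rank X * mobius intersection_poset setT X.

End Arrangement.
End Torus.

(* Main.v *)
(** Normalise each hyperplane to the image of [{x | l x - b \in Z}] with [l] a
    primitive integral form.  Lifted to [R^n], the faces of the arrangement are
    cut out by fixing, for every form, either its integral value or the open
    unit interval containing it.

    If the normals did not span, some nonzero integral vector [v] would be
    orthogonal to all of them, and the closed loop [x + t v] would lie in a
    region; the region being a ball, the loop would be contractible, which a
    winding number computed on a fine grid forbids.  So the normals span, and
    the coatoms of the poset are the zero-dimensional flats.

    For a flat [Y], let [E(Y)] be the sum of [(-1)^codim F] over the faces [F]
    contained in [Y].  Removing a hyperplane does not change [E(Y)] as long as
    the remaining normals span, because the faces merged into one bounded face
    are slices of it alternating between open slabs and walls, starting and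
    ending with slabs.  Once the arrangement is minimal, either [Y] is a point
    and [E(Y) = (-1)^n], or some hyperplane is independent of the others and
    exchanging its walls with the adjacent slabs shows that [E(Y) = 0].

    Finally the sum of [mu(0, Y)] over the flats [Y] containing a face [F] is
    [1] if [F] is a region and [0] otherwise, so the number of regions is the
    sum of [mu(0, Y) E(Y)] over all flats. *)

From mathcomp Require Import all_boot all_order all_algebra finmap.
From mathcomp Require Import all_classical all_reals all_analysis.
From mathcomp Require Import zify ring lra.
Require Import Defs.

Set Implicit Arguments.
Unset Strict Implicit.
Unset Printing Implicit Defensive.

Import Order.TTheory GRing.Theory Num.Theory.
Import numFieldNormedType.Exports.

Local Open Scope classical_set_scope.
Local Open Scope ring_scope.

(** * Integer codes separating the integers from the open unit intervals *)

Section Code.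
Context {R : realType}.
Implicit Types y : R.

(* [code y] is [2k] at the integer [k] and [2k + 1] on the open interval
   [(k, k + 1)]. *)
Definition code y : int := Num.floor y + Num.ceil y.

(* The open star of the face containing [y]: [(k - 1, k + 1)] at the integer
   [k], and [(k, k + 1)] on that interval. *)
Definition star y : set R :=
  [set y' | (Num.ceil y)%:~R - 1 < y' < (Num.floor y)%:~R + 1].

Lemma codeP y :
  [/\ y = (Num.floor y)%:~R, Num.ceil y = Num.floor y & y \is a Num.int] \/
  [/\ (Num.floor y)%:~R < y < (Num.floor y)%:~R + 1,
      Num.ceil y = Num.floor y + 1 & y \isn't a Num.int].
Proof.
have /andP[h1 h2] := floor_itv y; rewrite ceil_floor.
case: (boolP (y \is a Num.int)) => yi; [left|right].
  by split=> //=; rewrite ?addr0 ?floorK.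
split=> //; rewrite intrD in h2; rewrite h2 lt_neqAle h1 !andbT.
by rewrite -intrEfloor.
Qed.

Lemma dvdz_code y : (2 %| code y)%Z = (y \is a Num.int).
Proof.
rewrite /code; case: (codeP y) => -[_ -> h]; rewrite ?h ?(negPf h).
  by apply/dvdzP; exists (Num.floor y); lia.
by apply/negP => /dvdzP[q]; lia.
Qed.

Lemma codeDz y (k : int) : code (y + k%:~R) = code y + 2 * k.
Proof.
rewrite /code floorDrz ?ceilDrz ?intr_int // intrKfloor intrKceil.
by rewrite addrACA -[k + k]mulr2n mulr_natl.
Qed.

Lemma le_code : {homo code : y y' / y <= y'}.
Proof. by move=> y y' h; apply: lerD; [exact: le_floor | exact: le_ceil]. Qed.

Lemma code_lt y y' : code y < code y' -> y < y'.
Proof. by move=> h; rewrite ltNge; apply/negP => /le_code; rewrite leNgt h. Qed.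

(** An even [c] gives an integer, an odd one the midpoint of a unit interval. Half-integers thus
    serve as canonical values when a point with a prescribed code has to be produced. *)
Lemma code_half (c : int) : code (c%:~R / 2 : R) = c.
Proof.
have -> : c = (c %/ 2)%Z * 2 + (c %% 2)%Z by rewrite -divz_eq.
set q := (c %/ 2)%Z; have : (c %% 2)%Z = 0 \/ (c %% 2)%Z = 1 by lia.
case=> ->.
  have -> : (q * 2 + 0)%:~R / 2 = q%:~R :> R by rewrite addr0 intrM; field.
  by rewrite /code intrKfloor intrKceil; lia.
rewrite /code (@floor_def _ _ q) ?(@ceil_def _ _ (q + 1)); try lia.
  by rewrite addrK !intrD intrM; apply/andP; split; lra.
by rewrite !intrD intrM; apply/andP; split; lra.
Qed.

Lemma code_eq_floor y y' : code y = code y' ->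
  Num.floor y = Num.floor y' /\ Num.ceil y = Num.ceil y'.
Proof.
rewrite /code.
by case: (codeP y) => -[_ -> _]; case: (codeP y') => -[_ -> _]; lia.
Qed.

Lemma code_eq_int y y' : code y = code y' ->
  (y \is a Num.int) = (y' \is a Num.int).
Proof. by move=> h; rewrite -!dvdz_code h. Qed.

Lemma code_int_inj y y' : y \is a Num.int -> code y = code y' -> y = y'.
Proof.
move=> yi e; have yi' := yi; rewrite (code_eq_int e) in yi'.
by have [h _] := code_eq_floor e; rewrite -(floorK yi) h floorK.
Qed.

Lemma code_dist y y' : code y = code y' -> `|y' - y| < 1.
Proof.
move=> e; have [h _] := code_eq_floor e.
have /andP[h1 h2] := floor_itv y; have /andP[h3 h4] := floor_itv y'.
rewrite ltr_norml; rewrite h !intrD in h1 h2 h4; lra.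
Qed.

Lemma star_refl y : star y y.
Proof.
rewrite /star/=; have /andP[h1 h2] := floor_itv y.
have /andP[h3 h4] := ceil_itv y; rewrite intrD in h2; rewrite intrB in h3; lra.
Qed.

Let star_floor y y' : star y y' ->
  Num.ceil y - 1 < Num.ceil y' /\ Num.floor y' < Num.floor y + 1.
Proof.
by move=> /andP[]; rewrite ceil_gt_int floor_lt_int intrB intrD.
Qed.

(** The star of an integer contains no other integer, and the star of a non-integer is a single open
    unit interval. *)
Lemma star_code y y' : star y y' ->
  (y \is a Num.int) = (y' \is a Num.int) -> code y' = code y.
Proof.
move=> /star_floor[h1 h2] h.
rewrite /code; case: (codeP y) => -[_ e i]; case: (codeP y') => -[_ e' i'];
  rewrite ?i ?i' // ?(negPf i) in h; rewrite ?h in i'; lia.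
Qed.

Lemma star_odd y y' : y \isn't a Num.int -> star y y' -> code y' = code y.
Proof.
move=> i /star_floor[h1 h2].
case: (codeP y) i => -[_ e i]; rewrite ?i // => _.
by rewrite /code; case: (codeP y') => -[_ e' i']; lia.
Qed.

Lemma star_left y y' : y \is a Num.int -> star y y' -> y' < y ->
  code y' = code y - 1.
Proof.
move=> i s yy; case: (codeP y) => -[ey e iy]; last by rewrite i in iy.
have [h1 h2] := star_floor s; rewrite e in h1.
have {}yy : Num.floor y' < Num.floor y by rewrite floor_lt_int -ey.
by rewrite /code; case: (codeP y') => -[_ e' i']; lia.
Qed.

Lemma star_right y y' : y \is a Num.int -> star y y' -> y < y' ->
  code y' = code y + 1.
Proof.
move=> i s yy; case: (codeP y) => -[ey e iy]; last by rewrite i in iy.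
have [h1 h2] := star_floor s; rewrite e in h1.
have {}yy : Num.floor y < Num.ceil y' by rewrite ceil_gt_int -ey.
by rewrite /code; case: (codeP y') => -[_ e' i']; lia.
Qed.

Lemma star_near y : exists2 e, 0 < e & forall y', `|y' - y| < e -> star y y'.
Proof.
exists (Num.min (y - ((Num.ceil y)%:~R - 1)) ((Num.floor y)%:~R + 1 - y)).
  by have /andP[h1 h2] := star_refl y; rewrite lt_min !subr_gt0 h1 h2.
by move=> y'; rewrite lt_min !ltr_norml /star/=; lra.
Qed.

Lemma open_star y : open (star y).
Proof.
suff -> : star y = `](Num.ceil y)%:~R - 1, (Num.floor y)%:~R + 1[%classic.
  exact: interval_open.
by apply/seteqP; split=> x /=; rewrite in_itv.
Qed.

(** [code] is monotone, so it is constant between two points where it agrees. This makes the lifted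
    faces convex. *)
Lemma code_convex y y' (t : R) : code y = code y' -> 0 <= t <= 1 ->
  code (y + t * (y' - y)) = code y.
Proof.
wlog yy : y y' t / y <= y' => [hw e ht|].
  case: (leP y y') => h; first exact: hw.
  have -> : y + t * (y' - y) = y' + (1 - t) * (y - y') by ring.
  by rewrite e; apply: hw; [exact: ltW | | move/andP: ht => [? ?]; lra].
move=> e /andP[t0 t1]; apply/eqP; rewrite eq_le {1}e.
have yy0 : 0 <= y' - y by rewrite subr_ge0.
by rewrite !le_code //; nra.
Qed.

End Code.

(** * Faces of a periodic arrangement *)

Section Arrangement.
Context {R : realType} {n m : nat} (A : 'M[int]_(m, n)) (b : 'I_m -> R).
Implicit Types (x w v : 'rV[R]_n) (z : 'rV[int]_n) (I S : {set 'I_m}).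

Local Notation proj := (@torus_proj R n).

Definition realmx : 'M[R]_(m, n) := map_mx intr A.
Definition lf x i : R := (realmx *m x^T) i ord0.
(* The [i]-th hyperplane is the image of the points where [ev x i] is integral;
   [act x] collects the hyperplanes through [x]. *)
Definition ev x i : R := lf x i - b i.
Definition act x : {set 'I_m} := [set i | ev x i \is a Num.int].
Definition lat z : 'rV[R]_n := map_mx intr z.

Lemma lfD x w i : lf (x + w) i = lf x i + lf w i.
Proof. by rewrite /lf raddfD mulmxDr mxE. Qed.

Lemma lfZ (t : R) x i : lf (t *: x) i = t * lf x i.
Proof. by rewrite /lf linearZ -scalemxAr mxE. Qed.

Lemma lfN x i : lf (- x) i = - lf x i.
Proof. by rewrite /lf raddfN mulmxN mxE. Qed.

Lemma lfB x w i : lf (x - w) i = lf x i - lf w i.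
Proof. by rewrite lfD lfN. Qed.

Lemma lfE x i : lf x i = \sum_j (A i j)%:~R * x ord0 j.
Proof. by rewrite /lf mxE; apply: eq_bigr => j _; rewrite !mxE. Qed.

Lemma lf_lat z i : lf (lat z) i = ((A *m z^T) i ord0)%:~R.
Proof.
rewrite lfE mxE rmorph_sum; apply: eq_bigr => j _.
by rewrite !mxE rmorphM.
Qed.

Lemma evE x i : ev x i = lf x i - b i.
Proof. by []. Qed.

Lemma evD x w i : ev (x + w) i = ev x i + lf w i.
Proof. by rewrite /ev lfD addrAC. Qed.

Lemma ev_lat x z i : ev (x + lat z) i = ev x i + ((A *m z^T) i ord0)%:~R.
Proof. by rewrite evD lf_lat. Qed.

Lemma latN z : lat (- z) = - lat z.
Proof. by rewrite /lat map_mxN. Qed.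

Lemma ev_segment x w (t : R) i :
  ev (x + t *: (w - x)) i = ev x i + t * (ev w i - ev x i).
Proof. by rewrite evD lfZ lfB /ev; ring. Qed.

Lemma ev_lat_int x z i :
  (ev (x + lat z) i \is a Num.int) = (ev x i \is a Num.int).
Proof. by rewrite ev_lat rpredDr // intr_int. Qed.

Lemma act_lat x z : act (x + lat z) = act x.
Proof. by apply/setP => i; rewrite !inE ev_lat_int. Qed.

Lemma torus_proj_eq x w : proj x = proj w <-> exists z, w = x + lat z.
Proof.
split.
  move=> /eqmodP /= /forallP h.
  exists (\row_j Num.floor (w ord0 j - x ord0 j)).
  apply/rowP => j; rewrite !mxE floorK; first by ring.
  by rewrite -opprB rpredN.
move=> [z ->]; apply/eqmodP/forallP => j.
by rewrite !mxE opprD addNKr rpredN intr_int.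
Qed.

Lemma torus_proj_lat x z : proj (x + lat z) = proj x.
Proof. by apply/esym/torus_proj_eq; exists z. Qed.

Lemma torus_proj_surj (p : torus R n) : exists x, proj x = p.
Proof. by exists (repr p); rewrite /torus_proj reprK. Qed.

(** Only the forms in [I] are constrained. With all indices these are the lifted faces of the
    arrangement; with [I] inside [act x] the image in the torus is a flat through [x]. *)
Definition cellC I x : set 'rV[R]_n :=
  [set w | forall i, i \in I -> code (ev w i) = code (ev x i)].

Definition cell I x : set (torus R n) := proj @` cellC I x.

Lemma code_lat x z i :
  code (ev (x + lat z) i) = code (ev x i) + 2 * (A *m z^T) i ord0.
Proof. by rewrite ev_lat codeDz. Qed.

Lemma cell_refl I x : cell I x (proj x).
Proof. by exists x. Qed.

Lemma mem_cell I x w : cell I x (proj w) <-> exists z, cellC I x (w + lat z).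
Proof.
split; last by move=> [z h]; exists (w + lat z); rewrite ?torus_proj_lat.
by move=> [w' h /esym/torus_proj_eq[z e]]; exists z; rewrite -e.
Qed.

Lemma cell_lat I x z : cell I (x + lat z) = cell I x.
Proof.
have sub y z' : cell I (y + lat z') `<=` cell I y.
  move=> _ [w h <-]; apply/mem_cell; exists (- z') => i iI.
  have e : (A *m (- z')^T) i ord0 = - (A *m z'^T) i ord0.
    by rewrite linearN mulmxN mxE.
  by rewrite code_lat h // code_lat e; ring.
apply/seteqP; split; first exact: sub.
by rewrite -{1}[x](addrK (lat z)) -latN; exact: sub.
Qed.

Lemma cellC_eq I x w : cellC I x w -> cellC I w = cellC I x.
Proof.
by move=> h; apply/seteqP; split=> y hy i iI; rewrite hy // h.
Qed.

Lemma cellC_cell_eq I x w : cellC I x w -> cell I w = cell I x.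
Proof. by move=> h; rewrite /cell (cellC_eq h). Qed.

Lemma cell_eq I x w : cell I x (proj w) -> cell I w = cell I x.
Proof.
by move=> /mem_cell[z /cellC_eq h]; rewrite -(cell_lat _ w z) /cell h.
Qed.

Lemma cell_eqP I x w : cell I w = cell I x -> exists z, cellC I x (w + lat z).
Proof. by move=> e; apply/mem_cell; rewrite -e; exact: cell_refl. Qed.

Lemma cellS I S x : S \subset I -> cell I x `<=` cell S x.
Proof.
move=> SI _ [w h <-]; exists w => // i iS.
by apply: h; apply: (fintype.subsetP SI).
Qed.

Lemma cellC_act I x w i : cellC I x w -> i \in I ->
  (i \in act w) = (i \in act x).
Proof. by move=> h iI; rewrite !inE; apply: code_eq_int; apply: h. Qed.

Lemma cellC_actI I x w : cellC I x w -> act w :&: I = act x :&: I.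
Proof.
move=> h; apply/setP => i; rewrite !finset.in_setI.
by case: (boolP (i \in I)) => iI; rewrite ?andbF // !andbT (cellC_act h).
Qed.

Lemma cell_actI I x w : cell I w = cell I x -> act w :&: I = act x :&: I.
Proof. by move=> /cell_eqP[z /cellC_actI]; rewrite act_lat. Qed.

Lemma cell_meet_sub I S x w p : S \subset I ->
  cell I x p -> cell S w p -> cell I x `<=` cell S w.
Proof.
have [y <-] := torus_proj_surj p => SI h1 h2.
by rewrite -(cell_eq h1) -(cell_eq h2); exact: cellS.
Qed.

(** Each form has room to move inside its star; the minimum over the finitely many forms works for
    all of them. *)
Lemma cellC_perturb x v : exists2 e, 0 < e & forall t : R, `|t| < e ->
  forall i, star (ev x i) (ev (x + t *: v) i).
Proof.
have h i : exists e, 0 < e /\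
    forall t : R, `|t| < e -> star (ev x i) (ev (x + t *: v) i).
  have [e e0 he] := star_near (ev x i).
  exists (e / (1 + `|lf v i|)); split=> [|t ht].
    by rewrite divr_gt0 // ltr_pwDl.
  apply: he; rewrite evD addrC addKr lfZ normrM.
  have p : 0 < 1 + `|lf v i| by rewrite ltr_pwDl.
  rewrite ltr_pdivlMr // in ht; apply: le_lt_trans ht.
  by apply: ler_wpM2l => //; rewrite lerDr.
have [e he] := choice h.
exists (\big[Num.min/1]_i e i).
  apply: (big_ind (fun y => 0 < y)) => [//|y y' y0 y'0|i _].
    by rewrite lt_min y0.
  exact: (he i).1.
move=> t ht i; apply: (he i).2; apply: lt_le_trans ht _.
exact: bigmin_le.
Qed.

Lemma lf_continuous i : continuous (lf ^~ i).
Proof.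
have -> : lf ^~ i = fun x => \sum_j (A i j)%:~R * x ord0 j.
  by apply/funext => x; exact: lfE.
suff h (s : seq 'I_n) (x : 'rV[R]_n) : \sum_(j <- s) (A i j)%:~R * w ord0 j
    @[w --> x] --> \sum_(j <- s) (A i j)%:~R * x ord0 j by move=> x; exact: h.
elim: s => [|j s IH].
  by under eq_fun do rewrite big_nil; rewrite big_nil; exact: cvg_cst.
under eq_fun do rewrite big_cons; rewrite big_cons.
apply: cvgD; last exact: IH.
by apply: cvgM; [exact: cvg_cst|exact: coord_continuous].
Qed.

Lemma ev_continuous i : continuous (ev ^~ i).
Proof.
move=> x; apply: (@cvgB _ _ _ (nbhs (x : 'rV[R]_n))); last exact: cvg_cst.
exact: lf_continuous.
Qed.

Lemma line_continuous x v : continuous (fun t : R => x + t *: v).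
Proof.
move=> t; apply: cvgD; first exact: cvg_cst.
by apply: cvgZr_tmp; exact: cvg_id.
Qed.

Lemma torus_proj_continuous : continuous proj.
Proof. exact: pi_continuous. Qed.

(** The preimage of the image is the union of the lattice translates of [U]. *)
Lemma open_torus_proj (U : set 'rV[R]_n) : open U -> open (proj @` U).
Proof.
move=> oU; rewrite /open/= /quotient_open.
have -> : (\pi_(torus R n)%qT @^-1` (proj @` U)) =
    \bigcup_(z in [set: 'rV[int]_n]) [set x | U (lat z + x)].
  apply/seteqP; split => x /=.
    by move=> [w Uw /esym/torus_proj_eq[z e]]; exists z => //=; rewrite addrC -e.
  by move=> [z _ /= h]; exists (lat z + x) => //; rewrite addrC torus_proj_lat.
apply: bigcup_open => z _; apply: open_comp => // x _.
by apply: (@cvgD _ _ _ (nbhs (x : 'rV[R]_n))); [exact: cvg_cst|exact: cvg_id].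
Qed.

Definition starC I x : set 'rV[R]_n :=
  [set w | forall i, i \in I -> star (ev x i) (ev w i)].

Lemma open_starC I x : open (starC I x).
Proof.
suff h w : starC I x w -> nbhs w (starC I x) by rewrite openE => w; exact: h.
move=> h.
have : \forall w' \near w, forall i, i \in I -> star (ev x i) (ev w' i).
  apply: (@filter_forall _ _
    (fun i w' => i \in I -> star (ev x i) (ev w' i)) (nbhs w)) => i.
  case: (boolP (i \in I)) => iI; last exact: nearW.
  have /(@ev_continuous i w) c : nbhs (ev w i) (star (ev x i)).
    by apply: open_nbhs_nbhs; split; [exact: open_star|exact: h].
  by apply: (@filterS _ (nbhs w) _ _ _ _ c) => w' /=.
by apply: filterS => w' h' i; exact: h'.
Qed.

(** One notion covering two cases: for [I] inside [act x] it is the intersection of the hyperplanes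
    in [I], and for all indices with [act x] empty it is the complement of the arrangement. Flats
    and regions are both components of such sets. *)
Definition pattern I x : set (torus R n) :=
  proj @` [set w | forall i, i \in I ->
    (ev w i \is a Num.int) = (ev x i \is a Num.int)].

Lemma pattern_proj I x w : pattern I x (proj w) ->
  forall i, i \in I -> (ev w i \is a Num.int) = (ev x i \is a Num.int).
Proof.
move=> [w' h /esym/torus_proj_eq[z e]] i iI.
by rewrite -(h i iI) e ev_lat_int.
Qed.

Lemma cell_segment I x w : cellC I x w ->
  forall t : R, 0 <= t <= 1 -> cellC I x (x + t *: (w - x)).
Proof.
by move=> h t ht i iI; rewrite ev_segment code_convex // h.
Qed.

Lemma pattern_star I x w : pattern I x (proj w) -> starC I x w -> cellC I x w.
Proof.
by move=> h s i iI; apply: star_code; [exact: s|rewrite (pattern_proj h)].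
Qed.

(* Cells are connected as images of convex sets; within the points of the same
   integrality pattern a cell is the trace of its open star, hence clopen. *)
Lemma component_cell I x :
  connected_component (pattern I x) (proj x) = cell I x.
Proof.
have px : pattern I x (proj x) by exists x.
apply/seteqP; split; last first.
  move=> _ [w h <-].
  pose f (t : R) := proj (x + t *: (w - x)).
  have fc : continuous f.
    move=> t; apply: (@continuous_comp _ _ _ (fun t : R => x + t *: (w - x)) proj).
      exact: line_continuous.
    exact: torus_proj_continuous.
  have c : connected (f @` `[0, 1]%classic).
    apply: connected_continuous_connected; last exact: continuous_subspaceT.
    exact: segment_connected.
  apply: (@connected_component_max _ _ (f @` `[0, 1]%classic)) => //.
  - by exists 0; [rewrite /= in_itv /= lexx ler01|rewrite /f scale0r addr0].
  - move=> _ [t ht <-]; rewrite /= in_itv /= in ht.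
    exists (x + t *: (w - x)) => // i iI /=.
    by apply: code_eq_int; apply: cell_segment h _ _ _ _.
  - exists 1; first by rewrite /= in_itv /= lexx ler01.
    by rewrite /f scale1r addrC subrK.
set B := connected_component _ _.
have BP : B `<=` pattern I x by exact: connected_component_sub.
have Bx : B (proj x) by exact: connected_component_refl.
suff <- : B `&` cell I x = B by move=> ? [].
apply: (component_connected (A := pattern I x) (x := proj x)).
- by exists (proj x); split=> //; exact: cell_refl.
- exists (proj @` starC I x); first by apply: open_torus_proj; exact: open_starC.
  apply/seteqP; split=> p [Bp [w h e]]; split=> //.
    exists w => // i iI; have [e1 e2] := code_eq_floor (h i iI).
    by have := star_refl (ev w i); rewrite /star/= e1 e2.
  by exists w => //; apply: pattern_star => //; rewrite e; exact: BP.
- pose V := \bigcup_(w in [set w | pattern I x (proj w) /\ ~ cell I x (proj w)])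
     (proj @` starC I w).
  exists (~` V).
    apply: open_closedC; apply: bigcup_open => w _.
    by apply: open_torus_proj; exact: open_starC.
  apply/seteqP; split=> p [Bp h]; split=> //.
    move=> [w [pw ncw] [w' s e]]; apply: ncw; rewrite -e in h Bp.
    have pw' : pattern I w (proj w').
      exists w' => // i iI.
      by rewrite (pattern_proj pw) // (pattern_proj (BP _ Bp)).
    have /cellC_eq e' := pattern_star pw' s.
    rewrite -(cell_eq h) /cell e'; exact: cell_refl.
  have [w e] := torus_proj_surj p; apply: contrapT => nc; apply: h.
  exists w; first by rewrite /= e; split=> //; exact: BP.
  by exists w => // i iI; exact: star_refl.
Qed.

End Arrangement.

(** * Spans of normals *)

Section Span.
Context {R : realType} {n m : nat} (A : 'M[int]_(m, n)).
Implicit Types (v : 'rV[R]_n) (I S : {set 'I_m}).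

Local Notation L := (@realmx R n m A).
Local Notation lf := (@lf R n m A).

Definition spanmx I : 'M[R]_n := (\sum_(i in I) <<row i L>>)%MS.
Definition rk I : nat := \rank (spanmx I).
Definition spanning I : bool := rk I == n.

Lemma spanningE I : spanning I = (rk I == n).
Proof. by []. Qed.

Lemma rk_set0 : rk finset.set0 = 0%N.
Proof. by rewrite /rk /spanmx big_set0 mxrank0. Qed.

Lemma row_spanmx I i : i \in I -> (row i L <= spanmx I)%MS.
Proof. by move=> iI; rewrite -genmxE; apply: sumsmx_sup iI _. Qed.

Lemma row_lf v i : row i L *m v^T = (lf v i)%:M.
Proof. by apply/matrixP => a c; rewrite !ord1 -row_mul mxE [RHS]mxE mulr1n. Qed.

Lemma spanmx_comb I j : (row j L <= spanmx I)%MS ->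
  exists c : 'I_m -> R, forall v, lf v j = \sum_(i in I) c i * lf v i.
Proof.
move=> /sub_sumsmxP[u e].
have h i : exists c : R, u i *m <<row i L>>%MS = c *: row i L.
  by apply/sub_rVP; rewrite -(genmxE (row i L)); exact: submxMl.
have [c hc] := choice h; exists c => v.
suff : (lf v j)%:M = (\sum_(i in I) c i * lf v i)%:M :> 'M[R]_1.
  by move/matrixP/(_ ord0 ord0); rewrite !mxE !mulr1n.
rewrite -row_lf e mulmx_suml raddf_sum; apply: eq_bigr => i _ /=.
by rewrite hc -scalemxAl row_lf scale_scalar_mx.
Qed.

Lemma spanmx_vanish I j v : (row j L <= spanmx I)%MS ->
  (forall i, i \in I -> lf v i = 0) -> lf v j = 0.
Proof.
by move=> /spanmx_comb[c ->] h; rewrite big1 // => i iI; rewrite h // mulr0.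
Qed.

(** The columns of the cokernel matrix are orthogonal to the span; one of them pairs nontrivially
    with row [j] and is rescaled. *)
Lemma spanmx_witness I j : ~~ (row j L <= spanmx I)%MS ->
  exists v, (forall i, i \in I -> lf v i = 0) /\ lf v j = 1.
Proof.
rewrite submxE => /eqP h.
have [k hk] : exists k, (row j L *m cokermx (spanmx I)) ord0 k != 0.
  apply: contrapT => h'; apply: h; apply/rowP => k; rewrite [RHS]mxE.
  by apply: contrapT => hk; apply: h'; exists k; exact/eqP.
set c := (X in X != 0) in hk.
have e i : lf (c^-1 *: (col k (cokermx (spanmx I)))^T) i =
    c^-1 * (row i L *m cokermx (spanmx I)) ord0 k.
  rewrite lfZ; congr (_ * _).
  have := row_lf (col k (cokermx (spanmx I)))^T i.
  rewrite trmxK [X in _ *m X]colE mulmxA -[X in X = _]colE.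
  by move=> /matrixP/(_ ord0 ord0) h'; rewrite mxE [RHS]mxE mulr1n in h'.
exists (c^-1 *: (col k (cokermx (spanmx I)))^T); split=> [i iI|].
  rewrite e; have := row_spanmx iI; rewrite submxE => /eqP ->.
  by rewrite mxE mulr0.
by rewrite e mulVf.
Qed.

Lemma rk_setU1 I j : j \notin I ->
  rk (j |: I) = (rk I + ~~ (row j L <= spanmx I)%MS)%N.
Proof.
move=> jI; rewrite /rk {1}/spanmx big_setU1 //= -/(spanmx I).
have e : (<<row j L>> + spanmx I :=: row j L + spanmx I)%MS.
  by apply: adds_eqmx; [exact: genmxE|].
rewrite e; case: (boolP (row j L <= _)%MS) => h.
  by rewrite addn0 (addsmx_idPr h).
apply/eqP; rewrite eqn_leq; apply/andP; split.
  apply: leq_trans (mxrank_adds_leqif _ _) _.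
  by rewrite addnC leq_add2l rank_rV; case: eqP.
rewrite addn1; apply: rank_ltmx; rewrite ltmxE addsmxSr /=.
by apply: contra h => /(submx_trans (addsmxSl _ _)).
Qed.

Lemma spanningS I S : S \subset I -> spanning S -> spanning I.
Proof.
move=> SI; rewrite /spanning /rk => /eqP h; rewrite eqn_leq rank_leq_col -{1}h.
apply: mxrankS; apply/sumsmx_subP => i iS; rewrite genmxE.
by apply: row_spanmx; apply: (fintype.subsetP SI).
Qed.

Lemma spanning_row I j : spanning I -> (row j L <= spanmx I)%MS.
Proof. by move=> h; apply: submx_full. Qed.

End Span.

(** * Alternating sums over faces *)

(** A bounded convex set of integers is the interval between its extreme elements. These are odd,
    because an even member has both neighbours in the set. *)
Lemma odd_ends_interval (K : set int) (M : nat) :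
  K !=set0 -> (forall c, K c -> `|c| <= M%:Z) ->
  (forall (c1 c c2 : int), K c1 -> K c2 -> c1 <= c <= c2 -> K c) ->
  (forall c, K c -> (2 %| c)%Z -> K (c - 1) /\ K (c + 1)) ->
  exists (a : int) (N : nat), ~~ (2 %| a)%Z /\
    forall c, K c <-> a <= c <= a + (2 * N)%:Z.
Proof.
move=> [c0 Kc0] Kb Kc Kodd.
(* The shift by [M] turns the members of [K] into natural numbers, where least and greatest elements
   are available. *)
pose P (k : nat) : bool := `[< K (k%:Z - M%:Z) >].
have exP : exists k, P k.
  exists (absz (c0 + M%:Z)); apply/asboolP.
  suff -> : (absz (c0 + M%:Z))%:Z - M%:Z = c0 by [].
  by have := Kb _ Kc0; lia.
have ubP k : P k -> (k <= M + M)%N by move=> /asboolP/Kb; lia.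
case: (ex_minnP exP) => a0 /asboolP Ka amin.
case: (ex_maxnP exP ubP) => b0 /asboolP Kb0 bmax.
have lo c : K c -> a0%:Z - M%:Z <= c.
  move=> Kcc; suff /amin : P (absz (c + M%:Z)) by have := Kb _ Kcc; lia.
  apply/asboolP; have -> // : (absz (c + M%:Z))%:Z - M%:Z = c.
  by have := Kb _ Kcc; lia.
have hi c : K c -> c <= b0%:Z - M%:Z.
  move=> Kcc; suff /bmax : P (absz (c + M%:Z)) by have := Kb _ Kcc; lia.
  apply/asboolP; have -> // : (absz (c + M%:Z))%:Z - M%:Z = c.
  by have := Kb _ Kcc; lia.
have oa : ~~ (2 %| (a0%:Z - M%:Z))%Z.
  by apply/negP => /(Kodd _ Ka)[/lo]; lia.
have ob : ~~ (2 %| (b0%:Z - M%:Z))%Z.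
  by apply/negP => /(Kodd _ Kb0)[_ /hi]; lia.
have ab := hi _ Ka.
exists (a0%:Z - M%:Z), ((b0 - a0)./2); split=> // c.
have eb : a0%:Z - M%:Z + (2 * (b0 - a0)./2)%:Z = b0%:Z - M%:Z.
  have : ~~ odd (b0 - a0) by lia.
  by lia.
rewrite eb; split=> [Kcc|]; first by rewrite lo // hi.
exact: Kc.
Qed.

Lemma alternating_sum (N : nat) :
  \sum_(k <- iota 0 (2 * N).+1) (-1) ^+ k = 1 :> int.
Proof.
rewrite -[iota _ _]/(index_iota 0 (2 * N).+1); elim: N => [|N IH].
  by rewrite muln0 big_nat1.
have -> : (2 * N.+1).+1 = (2 * N).+3 by lia.
by rewrite big_nat_recr // big_nat_recr //= IH !exprS; ring.
Qed.

Section EulerSum.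
Context {R : realType} {n m : nat} (A : 'M[int]_(m, n)) (b : 'I_m -> R).
Implicit Types (x w v : 'rV[R]_n) (z : 'rV[int]_n) (I S : {set 'I_m}).
Implicit Types (F G y : set (torus R n)).

Local Notation proj := (@torus_proj R n).
Local Notation L := (@realmx R n m A).
Local Notation lf := (lf A).
Local Notation ev := (ev A b).
Local Notation act := (act A b).
Local Notation cell := (cell A b).
Local Notation cellC := (cellC A b).
Local Notation rk := (@rk R n m A).
Local Notation spanning := (@spanning R n m A).
Local Notation spanmx := (@spanmx R n m A).

Definition cells I : set (set (torus R n)) := range (cell I).

(** A lattice translation brings the base point into the unit cube. There [M i] bounds the [i]-th
    value and [K] bounds all codes, so a cell is determined by a vector of codes, shifted by [K]
    into a finite range. *)
Lemma cells_finite I : finite_set (cells I).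
Proof.
pose M i : R := \sum_j `|(A i j)%:~R| + `|b i|.
pose K := (\sum_i (absz (code (- M i)%R) + absz (code (M i))))%N.
pose f (c : {ffun 'I_m -> 'I_(K + K).+1}) : set (torus R n) :=
  proj @` [set w | forall i, i \in I -> code (ev w i) = (c i)%:Z - K%:Z].
apply: (@sub_finite_set _ _ (f @` setT)); last first.
  by apply: finite_image; exact: finite_finset.
move=> _ [x0 _ <-].
pose z : 'rV[int]_n := \row_j (- Num.floor (x0 ord0 j)).
rewrite -(cell_lat _ _ _ x0 z); set x := x0 + _.
have x01 j : 0 <= x ord0 j < 1.
  rewrite !mxE intrN; have /andP[h1 h2] := floor_itv (x0 ord0 j).
  by rewrite subr_ge0 h1 /= ltrBlDl; rewrite intrD in h2.
have evM i : `|ev x i| <= M i.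
  rewrite !evE; apply: le_trans (ler_normB _ _) _; rewrite lerD2r lfE.
  apply: le_trans (ler_norm_sum _ _ _) _; apply: ler_sum => j _.
  rewrite normrM ler_piMr //; have := x01 j; rewrite ler_norml; lra.
have cK i : `|code (ev x i)| <= K%:Z.
  have := evM i; rewrite ler_norml => /andP[l1 l2].
  have h1 : code (- M i) <= code (ev x i) by exact: le_code.
  have h2 : code (ev x i) <= code (M i) by exact: le_code.
  have : (absz (code (- M i)%R) + absz (code (M i)) <= K)%N.
    by rewrite /K (bigD1 i) //= leq_addr.
  by move: h1 h2; lia.
have cK' i : (absz (code (ev x i) + K%:Z)%R < (K + K).+1)%N.
  by have := cK i; lia.
exists [ffun i => Ordinal (cK' i)] => //.
congr (proj @` _); apply/seteqP; split=> w h i iI; have := h i iI;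
  rewrite ffunE /=; have := cK i; set c := code (ev x i); lia.
Qed.

Lemma mem_cells I x : cell I x \in fset_set (cells I).
Proof. by rewrite in_fset_set ?inE; [exists x|exact: cells_finite]. Qed.

Lemma cellsP I F : F \in fset_set (cells I) -> exists x, F = cell I x.
Proof.
by rewrite in_fset_set ?inE; [case=> x _ <-; exists x|exact: cells_finite].
Qed.

(* The codimension of a cell is the rank of the hyperplanes containing it, so
   this is [(-1)^codim]. *)
Definition cell_sign I F : int :=
  (-1) ^+ rk (act (xget 0 [set x | F = cell I x]) :&: I).

Lemma cell_signE I x : cell_sign I (cell I x) = (-1) ^+ rk (act x :&: I).
Proof.
rewrite /cell_sign; case: xgetP => [w _ /= e|/(_ x)]; last by case.
by rewrite (cell_actI e).
Qed.

Definition euler_sum I y : int :=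
  \sum_(F <- fset_set (cells I) | `[< F `<=` y >]) cell_sign I F.

Lemma euler_sumE I y : euler_sum I y =
  \sum_(F <- fset_set (cells I) | `[< F `<=` y >]) cell_sign I F.
Proof. by []. Qed.

Lemma cell_sub I S x w : S \subset I ->
  cell I x `<=` cell S w -> exists z, cellC S w (x + lat z).
Proof. by move=> SI /(_ _ (cell_refl A b I x)) /mem_cell. Qed.

Lemma code_dir x v i : lf v i = 1 -> forall c : int,
  code (ev (x + (c%:~R / 2 - ev x i) *: v) i) = c.
Proof. by move=> h c; rewrite evD lfZ h mulr1 addrC subrK code_half. Qed.

Lemma ev_dir0 x v (t : R) i : lf v i = 0 -> ev (x + t *: v) i = ev x i.
Proof. by move=> h; rewrite evD lfZ h mulr0 addr0. Qed.

(** A lattice vector joining two points of one lifted cell is killed by the forms in [I], hence by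
    every form when [I] spans. So the [j]-th code distinguishes the pieces into which a new
    hyperplane cuts the cell, even after projection to the torus. *)
Lemma spanning_lat_code I x w j : spanning I ->
  cellC I x w -> forall z, cellC I x (w + lat z) -> ev (w + lat z) j = ev w j.
Proof.
move=> sI h z hz; rewrite evD.
suff -> : lf (lat z : 'rV[R]_n) j = 0 by rewrite addr0.
apply: (spanmx_vanish (spanning_row j sI)) => i iI.
rewrite lf_lat; have := hz i iI; rewrite code_lat h // => e.
have -> : (A *m z^T) i ord0 = 0 by lia.
by [].
Qed.

(** * Cutting a cell of a spanning family by one more hyperplane *)

Section AddOne.
Context (I : {set 'I_m}) (j : 'I_m) (x : 'rV[R]_n).
Context (jI : j \notin I).
Context (sI : spanning I).

Let codes : set int := [set code (ev w j) | w in cellC I x].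

Let piece (c : int) : set (torus R n) :=
  proj @` [set w | cellC I x w /\ code (ev w j) = c].

Let pieceE w : cellC I x w -> piece (code (ev w j)) = cell (j |: I) w.
Proof.
move=> h; apply/seteqP; split=> _ [w' h' <-]; exists w' => //.
  case: h' => h1 h2 i /setU1P[->//|iI]; by rewrite h1 // h.
split; last by apply: h'; exact: setU11.
by move=> i iI; rewrite -(h i iI); apply: h'; apply/setU1P; right.
Qed.

Let piece_inj c c' : codes c -> codes c' -> piece c = piece c' -> c = c'.
Proof.
move=> [w h1 <-] [w' h2 <-]; rewrite !pieceE // => /cell_eqP[z hz].
have <- : code (ev (w + lat z) j) = code (ev w' j) by apply: hz; exact: setU11.
rewrite (spanning_lat_code j sI h1 (z := z)) // => i iI.
by rewrite hz ?h2 //; apply/setU1P; right.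
Qed.

Let sum_pieces (s : seq int) : uniq s -> (forall c, c \in s <-> codes c) ->
  \sum_(G <- fset_set (cells (j |: I)) | `[< G `<=` cell I x >])
     cell_sign (j |: I) G = \sum_(c <- s) cell_sign (j |: I) (piece c).
Proof.
move=> us hs; rewrite -big_filter -(big_map piece xpredT (cell_sign _)).
apply: perm_big; apply: uniq_perm.
- by rewrite filter_uniq // fset_uniq.
- by rewrite map_inj_in_uniq // => c c' /hs h /hs h'; exact: piece_inj.
move=> G; rewrite mem_filter; apply/andP/mapP.
  move=> [/asboolP GF /cellsP[w e]]; subst G.
  have [z hz] := cell_sub (finset.subsetUr [set j]%SET I) GF.
  exists (code (ev (w + lat z) j)); first by apply/hs; exists (w + lat z).
  by rewrite pieceE // cell_lat.
move=> [c /hs[w h <-] ->]; rewrite pieceE //; split; last exact: mem_cells.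
apply/asboolP => p /(cellS (finset.subsetUr [set j]%SET I)).
by rewrite (cellC_cell_eq h).
Qed.

(* The [j]-th codes met on the bounded convex set [cellC I x] either reduce to
   a single value or form an interval of integers with odd ends. *)
Lemma cell_sum_setU1 :
  \sum_(G <- fset_set (cells (j |: I)) | `[< G `<=` cell I x >])
     cell_sign (j |: I) G = cell_sign I (cell I x).
Proof.
have actU w : cellC I x w ->
    act w :&: (j |: I) =
    if j \in act w then j |: (act x :&: I) else act x :&: I.
  move=> h; rewrite finset.setIUr (cellC_actI h).
  case: ifP => ja; first by rewrite (finset.setIidPr _) // finset.sub1set.
  suff -> : act w :&: [set j]%SET = finset.set0 by rewrite finset.set0U.
  by apply/eqP; rewrite finset.setI_eq0 disjoint_sym disjoints1 ja.
have jI' : j \notin act x :&: I by rewrite finset.in_setI (negPf jI) andbF.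
rewrite cell_signE.
case: (boolP (row j L <= spanmx (act x :&: I))%MS) => hj.
  (* Dependent case: the forms that are integral on the cell are constant there, hence so is the
     [j]-th, and there is a single piece of the same rank. *)
  have evj w : cellC I x w -> ev w j = ev x j.
    move=> h; rewrite -{1}[w](subrK x) addrC evD.
    suff -> : lf (w - x) j = 0 by rewrite addr0.
    apply: (spanmx_vanish hj) => i; rewrite finset.in_setI => /andP[ia iI].
    rewrite inE in ia.
    have := code_int_inj ia (esym (h i iI)); rewrite !evE lfB; lra.
  rewrite (sum_pieces (s := [:: code (ev x j)])) // => [|c].
    rewrite big_seq1 pieceE // cell_signE actU //; case: ifP => // _.
    by rewrite rk_setU1 // hj addn0.
  rewrite inE; split=> [/eqP ->|[w h <-]]; first by exists x.
  by rewrite evj.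
have [v [v0 vj]] := spanmx_witness hj.
(* Along [v] the integral forms of the cell do not change, and the others stay in their open
   intervals for small moves. *)
have move1 w : cellC I x w -> exists2 e, 0 < e & forall t, `|t| < e ->
    cellC I x (w + t *: v) /\ star (ev w j) (ev (w + t *: v) j).
  move=> h; have [e e0 he] := cellC_perturb A b w v.
  exists e => // t te; split; last exact: he.
  move=> i iI; rewrite -(h i iI).
  case: (boolP (i \in act x)) => ia.
    by rewrite ev_dir0 // v0 // finset.in_setI ia.
  apply: star_odd; last exact: he.
  by rewrite -(cellC_act h iI) inE in ia.
have [c0 hc0] := spanmx_comb (spanning_row j sI).
(* Spanning enters here: the [j]-th form is a combination of forms in [I], each varying by less than
   1 on the cell. *)
have cb : exists M : nat, forall c, codes c -> `|c| <= M%:Z.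
  pose D : R := \sum_(i in I) `|c0 i|.
  exists (absz (code (ev x j - D)%R) + absz (code (ev x j + D)%R))%N.
  move=> _ [w h <-].
  have : `|lf (w - x) j| <= D.
    rewrite hc0; apply: le_trans (ler_norm_sum _ _ _) _; apply: ler_sum => i iI.
    rewrite normrM ler_piMr //; have := code_dist (esym (h i iI)).
    rewrite lfB !evE => h'; apply: ltW; apply: le_lt_trans h'.
    by rewrite le_eqVlt; apply/orP; left; apply/eqP; congr (`| _ |); ring.
  rewrite ler_norml lfB => /andP[h1 h2].
  have /le_code l1 : ev x j - D <= ev w j by rewrite !evE; lra.
  have /le_code l2 : ev w j <= ev x j + D by rewrite !evE; lra.
  by move: l1 l2; lia.
have [M hM] := cb.
have conv c1 c c2 : codes c1 -> codes c2 -> c1 <= c <= c2 -> codes c.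
  move=> [w1 h1 e1] [w2 h2 e2] /andP[l1 l2].
  have [->|n1] := eqVneq c c1; first by exists w1.
  have [->|n2] := eqVneq c c2; first by exists w2.
  have {}l1 : code (ev w1 j) < code (c%:~R / 2 : R).
    by rewrite e1 code_half lt_neqAle eq_sym n1.
  have {}l2 : code (c%:~R / 2 : R) < code (ev w2 j).
    by rewrite e2 code_half lt_neqAle n2.
  have {}l1 := code_lt l1; have {}l2 := code_lt l2.
  have p : 0 < ev w2 j - ev w1 j by lra.
  (* The parameter at which the segment from [w1] to [w2] attains the value [c / 2], whose code is
     [c]. *)
  pose t := (c%:~R / 2 - ev w1 j) / (ev w2 j - ev w1 j).
  exists (w1 + t *: (w2 - w1)); last first.
    rewrite ev_segment divfK ?gt_eqF // addrC subrK; exact: code_half.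
  rewrite -(cellC_eq h1); apply: cell_segment; first by rewrite (cellC_eq h1).
  by rewrite /t divr_ge0 ?ler_pdivrMr //; lra.
have ends c : codes c -> (2 %| c)%Z -> codes (c - 1) /\ codes (c + 1).
  move=> [w h <-]; rewrite dvdz_code => wj; have [e e0 he] := move1 w h.
  have e2 : `|e / 2| < e by rewrite ger0_norm; lra.
  have e2' : `|- (e / 2)| < e by rewrite normrN.
  split; [have [h1 h2] := he _ e2' | have [h1 h2] := he _ e2].
    exists (w + (- (e / 2)) *: v) => //; apply: star_left => //.
    by rewrite evD lfZ vj; lra.
  exists (w + (e / 2) *: v) => //; apply: star_right => //.
  by rewrite evD lfZ vj; lra.
have ne : codes !=set0 by exists (code (ev x j)); exists x.
have [a [N [oa hN]]] := odd_ends_interval ne hM conv ends.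
rewrite (sum_pieces (s := [seq a + k%:Z | k <- iota 0 (2 * N).+1])); last first.
- move=> c; rewrite hN; split=> [/mapP[k]|h].
    by rewrite mem_iota => hk ->; lia.
  apply/mapP; exists (absz (c - a)); last by lia.
  by rewrite mem_iota; lia.
- by rewrite map_inj_uniq ?iota_uniq // => k k' /addrI[].
rewrite big_map; transitivity ((-1) ^+ rk (act x :&: I) *
    \sum_(k <- iota 0 (2 * N).+1) (-1) ^+ k : int); last first.
  by rewrite alternating_sum mulr1.
(* As [a] is odd, [a + k] is even exactly when [k] is odd; such a piece lies on a wall and its rank
   is one higher. *)
rewrite mulr_sumr big_seq [RHS]big_seq.
apply: eq_bigr => k; rewrite mem_iota => hk.
have [w h e] : codes (a + k%:Z) by apply/hN; lia.
rewrite -e pieceE // cell_signE actU // inE -dvdz_code e.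
case: ifP => hd.
  rewrite rk_setU1 // hj exprD; congr (_ * _).
  by rewrite -(signr_odd _ k); have -> : odd k = true by lia.
by rewrite -(signr_odd _ k) -[LHS]mulr1; have -> : odd k = false by lia.
Qed.

End AddOne.

End EulerSum.

(** * Evaluating the Euler sums by removing hyperplanes *)

Section EulerValue.
Context {R : realType} {n m : nat} (A : 'M[int]_(m, n)) (b : 'I_m -> R).
Implicit Types (x w v : 'rV[R]_n) (z : 'rV[int]_n) (I S : {set 'I_m}).
Implicit Types (F G y : set (torus R n)).

Local Notation proj := (@torus_proj R n).
Local Notation L := (@realmx R n m A).
Local Notation ev := (ev A b).
Local Notation act := (act A b).
Local Notation cell := (cell A b).
Local Notation cellC := (cellC A b).
Local Notation rk := (@rk R n m A).
Local Notation spanning := (@spanning R n m A).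
Local Notation spanmx := (@spanmx R n m A).
Local Notation cells := (cells A b).
Local Notation cell_sign := (cell_sign A b).
Local Notation euler_sum := (euler_sum A b).

(** Every cell of the larger family lies in exactly one cell of [I], and since [S] is inside [I] the
    two lie in [cell S w] together. Grouping the small cells by the large ones reduces the claim to
    [cell_sum_setU1]. *)
Lemma euler_sum_setU1 I S j w : S \subset I -> j \notin I -> spanning I ->
  euler_sum (j |: I) (cell S w) = euler_sum I (cell S w).
Proof.
move=> SI jI sI; rewrite !euler_sumE.
have IjI : I \subset j |: I by exact: finset.subsetUr.
transitivity (\sum_(F <- fset_set (cells I) | `[< F `<=` cell S w >])
   \sum_(G <- fset_set (cells (j |: I)) | `[< G `<=` F >])
     cell_sign (j |: I) G); last first.
  rewrite big_seq_cond [RHS]big_seq_cond.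
  by apply: eq_bigr => F /andP[/cellsP[x ->] _]; exact: cell_sum_setU1.
under [RHS]eq_bigr do rewrite big_mkcond.
rewrite [RHS]exchange_big /= big_mkcond big_seq [RHS]big_seq.
apply: eq_bigr => G /cellsP[x ->].
rewrite -big_mkcondr /=.
transitivity (\sum_(F <- fset_set (cells I) | F == cell I x)
   (if `[< cell (j |: I) x `<=` cell S w >]
    then cell_sign (j |: I) (cell (j |: I) x) else 0)).
  rewrite -big_filter (perm_big [:: cell I x]) ?big_seq1 //.
  apply: uniq_perm => //; first by rewrite filter_uniq // fset_uniq.
  move=> F; rewrite mem_filter inE.
  by case: eqP => // ->; rewrite mem_cells.
have Fx F : F \in fset_set (cells I) ->
    (F == cell I x) = `[< cell (j |: I) x `<=` F >].
  move=> /cellsP[u ->]; apply/eqP/asboolP => [->|/(cell_sub IjI)[z hz]].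
    exact: cellS.
  by rewrite -(cellC_cell_eq hz) cell_lat.
rewrite big_seq_cond [RHS]big_seq_cond.
under eq_bigl => F do rewrite (andb_id2l (@Fx F)).
rewrite [RHS]big_mkcond [LHS]big_mkcond; apply: eq_bigr => F _.
case: (boolP (F \in _)) => //= /[dup] hF /cellsP[u eF].
case: (boolP `[< cell (j |: I) x `<=` F >]) => /asboolP h;
  last by rewrite andbF.
rewrite andbT; have -> // : `[< cell (j |: I) x `<=` cell S w >] =
    `[< F `<=` cell S w >].
apply/asboolP/asboolP => h'; last exact: subset_trans h h'.
have px := cell_refl A b (j |: I) x.
rewrite eF; apply: (cell_meet_sub (p := proj x)) => //; last exact: h'.
by rewrite -eF; exact: h.
Qed.

Definition flip (c : int) : int := if (2 %| c)%Z then c + 1 else c - 1.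

Lemma flipD (c k : int) : flip (c + 2 * k) = flip c + 2 * k.
Proof. by rewrite /flip rpredDr ?dvdz_mulr //; case: ifP; lia. Qed.

Lemma flipK : involutive flip.
Proof.
by move=> c; rewrite /flip; case: (boolP (2 %| c)%Z) => h; case: ifP => h'; lia.
Qed.

Lemma flip_dvd c : (2 %| flip c)%Z = ~~ (2 %| c)%Z.
Proof. by rewrite /flip; case: (boolP (2 %| c)%Z) => h; lia. Qed.

(* When the normal of [H_j] is independent of the others, the values of the
   [j]-th code are unconstrained, and exchanging [2k] with [2k + 1] is a
   fixed-point-free sign-reversing involution on the cells. *)
Lemma euler_sum_flip I S j w : S \subset I -> j \in I -> j \notin S ->
  ~~ (row j L <= spanmx (I :\ j))%MS -> euler_sum I (cell S w) = 0.
Proof.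
move=> SI jI jS hj; have [v [v0 vj]] := spanmx_witness hj.
(* The move along [v] changes only the [j]-th of the forms in [I], bringing it to half of the
   flipped code. *)
pose mv x : 'rV[R]_n := x + ((flip (code (ev x j)))%:~R / 2 - ev x j) *: v.
have mvj x : code (ev (mv x) j) = flip (code (ev x j)) by exact: code_dir.
have mvi x i : i \in I -> i != j -> ev (mv x) i = ev x i.
  by move=> iI ij; rewrite ev_dir0 // v0 // finset.in_setD1 ij.
have mvC x u : cellC I x u -> cellC I (mv x) (mv u).
  move=> h i iI; have [->|ij] := eqVneq i j; first by rewrite !mvj h.
  by rewrite !mvi // h.
have mv_lat x z : cell I (mv (x + lat z)) = cell I (mv x).
  rewrite -[RHS](cell_lat _ _ _ _ z).
  apply: cellC_cell_eq => i iI; rewrite code_lat.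
  have [->|ij] := eqVneq i j; first by rewrite !mvj code_lat flipD.
  by rewrite !mvi // code_lat.
pose tau F := cell I (mv (xget 0 [set x | F = cell I x])).
have tauE x : tau (cell I x) = cell I (mv x).
  rewrite /tau; case: xgetP => [u _ /= e|/(_ x)]; last by case.
  have [z hz] := cell_eqP e.
  by rewrite -(mv_lat x z) (cellC_cell_eq (mvC _ _ hz)).
have mvK x : cell I (mv (mv x)) = cell I x.
  apply: cellC_cell_eq => i iI.
  have [->|ij] := eqVneq i j; first by rewrite !mvj flipK.
  by rewrite !mvi.
have tauK F : F \in fset_set (cells I) -> tau (tau F) = F.
  by move=> /cellsP[x ->]; rewrite !tauE mvK.
have tau_mem F : F \in fset_set (cells I) -> tau F \in fset_set (cells I).
  by move=> /cellsP[x ->]; rewrite tauE mem_cells.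
have tau_sign F : F \in fset_set (cells I) ->
    cell_sign I (tau F) = - cell_sign I F.
  move=> /cellsP[x ->]; rewrite tauE !cell_signE.
  pose B := (act x :&: I) :\ j.
  have jB : j \notin B by rewrite finset.in_setD1 eqxx.
  have rB : rk (j |: B) = (rk B).+1.
    rewrite rk_setU1 //.
    suff -> : (row j L <= spanmx B)%MS = false by rewrite addn1.
    apply: contraNF hj => hB; apply: (submx_trans hB).
    apply/sumsmx_subP => i hi; rewrite genmxE; apply: row_spanmx; move: hi.
    by rewrite !finset.in_setD1 finset.in_setI => /and3P[-> _ ->].
  have actE u : (forall i, i \in I -> i != j -> ev u i = ev x i) ->
      act u :&: I = if j \in act u then j |: B else B.
    move=> hu; apply/setP => i; case: ifP => ju.
      rewrite finset.in_setU1 finset.in_setD1 !finset.in_setI.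
      have [->|ij] := eqVneq i j; first by rewrite ju jI.
      by case: (boolP (i \in I)) => iI; rewrite ?andbF //= !andbT !inE hu.
    rewrite finset.in_setD1 !finset.in_setI.
    have [->|ij] := eqVneq i j; first by rewrite ju.
    by case: (boolP (i \in I)) => iI; rewrite ?andbF //= !andbT !inE hu.
  rewrite (actE (mv x)) ?(actE x) //; last by move=> i iI ij; rewrite mvi.
  rewrite !inE -!dvdz_code mvj flip_dvd.
  by case: (2 %| _)%Z => /=; rewrite rB exprS mulN1r ?opprK.
have tau_sub F : F \in fset_set (cells I) ->
    `[< tau F `<=` cell S w >] = `[< F `<=` cell S w >].
  suff sub F' : F' \in fset_set (cells I) -> F' `<=` cell S w ->
      tau F' `<=` cell S w.
    move=> hF; apply/asboolP/asboolP; last exact: sub.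
    by move=> h; rewrite -(tauK _ hF); apply: sub => //; exact: tau_mem.
  move=> /cellsP[x ->] /(cell_sub SI)[z hz]; rewrite tauE -(mv_lat x z).
  (* As [j] is not in [S], the move stays within [cell S w]. *)
  have -> : cell S w = cell S (mv (x + lat z)); last exact: cellS.
  apply/esym; apply: cellC_cell_eq => i iS.
  rewrite mvi ?hz //; first exact: (fintype.subsetP SI).
  by apply: contraNneq jS => <-.
have e : euler_sum I (cell S w) = - euler_sum I (cell S w).
  rewrite {1}euler_sumE (perm_big [seq tau F | F <- fset_set (cells I)]).
    rewrite big_map /= !euler_sumE -sumrN big_seq_cond [RHS]big_seq_cond.
    apply: eq_big => [F|F /andP[hF _]]; last exact: tau_sign.
    by case: (boolP (F \in _)) => //= hF; rewrite tau_sub.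
  apply: uniq_perm; first exact: fset_uniq.
    rewrite map_inj_in_uniq ?fset_uniq // => F G hF hG h.
    by rewrite -(tauK _ hF) h tauK.
  move=> F; apply/idP/mapP => [hF|[G hG ->]]; last exact: tau_mem.
  by exists (tau F); [exact: tau_mem|rewrite tauK].
by move: e; lia.
Qed.

(** The hyperplanes outside [S] can be removed one by one, since [S] alone already spans. At [I = S]
    the only cell left is [cell S w] itself, of codimension [n]. *)
Lemma euler_sum_spanning S w I : S \subset act w -> spanning S -> S \subset I ->
  euler_sum I (cell S w) = (-1) ^+ n.
Proof.
move=> Sw sS.
have [k] := ubnP #|I|; elim: k I => // k IH I; rewrite ltnS => cI SI.
have [<-|nS] := eqVneq S I.
  rewrite !euler_sumE -big_filter (perm_big [:: cell S w]) ?big_seq1 /=.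
    rewrite cell_signE (finset.setIidPr Sw); congr (_ ^+ _).
    exact/eqP.
  apply: uniq_perm => //; first by rewrite filter_uniq // fset_uniq.
  move=> F; rewrite mem_filter inE.
  apply/andP/eqP => [[/asboolP h /cellsP[x e]]|->].
    subst F; have [z hz] := cell_sub (subxx S) h.
    by rewrite -(cellC_cell_eq hz) cell_lat.
  by split; [exact/asboolP|exact: mem_cells].
have [j jI jS] : exists2 j, j \in I & j \notin S.
  apply/fintype.subsetPn; apply: contraNN nS => h.
  by rewrite finset.eqEsubset SI.
have SI' : S \subset I :\ j by rewrite subsetD1 SI.
rewrite -(finset.setD1K jI) euler_sum_setU1 ?setD11 //;
  last exact: spanningS SI' sS.
by apply: IH => //; move: cI; rewrite (cardsD1 j I) jI.
Qed.

(** Some [j] in [I] lies outside [S]. If [I :\ j] still spans, [j] is removed; otherwise its normal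
    is independent of the others and [euler_sum_flip] applies. *)
Lemma euler_sum_nonspanning S w I :
  ~~ spanning S -> spanning I -> S \subset I ->
  euler_sum I (cell S w) = 0.
Proof.
move=> sS.
have [k] := ubnP #|I|; elim: k I => // k IH I; rewrite ltnS => cI sI SI.
have [j jI jS] : exists2 j, j \in I & j \notin S.
  apply/fintype.subsetPn; apply: contra sS => h.
  by have -> : S = I by apply/eqP; rewrite finset.eqEsubset SI.
have SI' : S \subset I :\ j by rewrite subsetD1 SI.
case: (boolP (spanning (I :\ j))) => sIj.
  rewrite -(finset.setD1K jI) euler_sum_setU1 ?setD11 //.
  by apply: IH => //; move: cI; rewrite (cardsD1 j I) jI.
apply: (euler_sum_flip w SI jI jS).
apply: contra sIj => h; rewrite !spanningE.
move: sI; rewrite !spanningE -{1}(finset.setD1K jI).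
by rewrite rk_setU1 ?setD11 // h addn0.
Qed.

End EulerValue.

(** * Möbius inversion over the flats *)

Section Counting.
Context {R : realType} {n m : nat} (A : 'M[int]_(m, n)) (b : 'I_m -> R).
Context (H : 'I_m -> set (torus R n)).
Implicit Types (x w v : 'rV[R]_n) (z : 'rV[int]_n) (I S : {set 'I_m}).

Local Notation proj := (@torus_proj R n).
Local Notation L := (@realmx R n m A).
Local Notation lf := (lf A).
Local Notation ev := (ev A b).
Local Notation act := (act A b).
Local Notation cell := (cell A b).
Local Notation cellC := (cellC A b).
Local Notation spanning := (@spanning R n m A).
Local Notation spanmx := (@spanmx R n m A).
Local Notation cells := (cells A b).
Local Notation cell_sign := (cell_sign A b).
Local Notation euler_sum := (euler_sum A b).
Local Notation pattern := (pattern A b).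

Context (HE : forall i, H i = proj @` [set x | ev x i \is a Num.int]).
Context (Aprim : forall i, exists z, (A *m z^T) i ord0 = 1).

Lemma hyperplane_proj i x : H i (proj x) <-> i \in act x.
Proof.
rewrite HE inE; split=> [[w h /torus_proj_eq[z ->]]|h]; last by exists x.
by rewrite ev_lat_int.
Qed.

Lemma bigcap_pattern S x : S \subset act x ->
  \bigcap_(i in [set` S]) H i = pattern S x.
Proof.
move=> /fintype.subsetP Sx.
apply/seteqP; split=> p; have [w <-] := torus_proj_surj p.
  move=> h; exists w => // i iS; have := Sx i iS; rewrite inE => ->.
  by have /hyperplane_proj := h i iS; rewrite inE.
move=> /pattern_proj h i /= iS; apply/hyperplane_proj; rewrite inE h //.
by have := Sx i iS; rewrite inE.
Qed.

Lemma flatsP X : flats H X <->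
  X = set0 \/ exists S x, S \subset act x /\ X = cell S x.
Proof.
split=> [[->|[S [p hp ->]]]|[->|[S [x [Sx ->]]]]]; [by left| |by left|].
  have [x xp] := torus_proj_surj p; subst p.
  have Sx : S \subset act x.
    by apply/fintype.subsetP => i iS; apply/hyperplane_proj; exact: hp.
  by right; exists S, x; split=> //; rewrite (bigcap_pattern Sx) component_cell.
right; exists S, (proj x); last by rewrite (bigcap_pattern Sx) component_cell.
by move=> i /= iS; apply/hyperplane_proj; exact: (fintype.subsetP Sx).
Qed.

Lemma complement_pattern x : act x = finset.set0 ->
  (~` \bigcup_i H i) = pattern [set: 'I_m]%SET x.
Proof.
move=> ax; have nx i : ev x i \is a Num.int = false.
  by have := finset.in_set0 i; rewrite -ax inE.
apply/seteqP; split=> p; have [w <-] := torus_proj_surj p.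
  move=> h; exists w => // i _; rewrite nx; apply/negP => hi; apply: h.
  by exists i => //; apply/hyperplane_proj; rewrite inE.
move=> /pattern_proj h [i _ /hyperplane_proj]; rewrite inE h //.
by rewrite nx.
Qed.

Lemma regionsP X : regions H X <->
  exists x, act x = finset.set0 /\ X = cell [set: 'I_m]%SET x.
Proof.
split=> [[p hp ->]|[x [ax ->]]]; last first.
  exists (proj x); last by rewrite (complement_pattern ax) component_cell.
  by rewrite (complement_pattern ax); exists x.
have [x xp] := torus_proj_surj p; subst p; exists x.
have ax : act x = finset.set0.
  apply/setP => i; rewrite finset.in_set0; apply/negP => /hyperplane_proj hi.
  by apply: hp; exists i.
by rewrite (complement_pattern ax) component_cell.
Qed.

Lemma regions_finite : finite_set (regions H).
Proof.
apply: sub_finite_set (cells_finite A b [set: 'I_m]%SET).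
by move=> X /regionsP[x [_ ->]]; exists x.
Qed.

Lemma flats_finite : finite_set (flats H).
Proof.
apply: (@sub_finite_set _ _
  ([set set0] `|` \bigcup_(S in [set: {set 'I_m}]) cells S)).
  by move=> X /flatsP[->|[S [x [_ ->]]]]; [left|right; exists S => //; exists x].
rewrite finite_setU; split; first exact: finite_set1.
by apply: bigcup_finite => [|S _]; [exact: finite_finset|exact: cells_finite].
Qed.

Local Notation P := (intersection_poset H).

Lemma mem_poset (X : set (torus R n)) : (X \in P) = `[< flats H X >].
Proof.
rewrite /intersection_poset in_fset_set; last exact: flats_finite.
by apply/idP/asboolP; rewrite inE.
Qed.

Lemma dual_le (X Y : (set (torus R n))^d) :
  (X <= Y)%O = `[< (Y : set (torus R n)) `<=` X >].
Proof. by apply/idP/asboolP; rewrite leEdual => /subsetPset. Qed.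

Lemma dual_lt (X Y : (set (torus R n))^d) :
  (X < Y)%O = (X != Y) && `[< (Y : set (torus R n)) `<=` X >].
Proof. by rewrite lt_neqAle dual_le. Qed.

Lemma cell_set0 x : cell finset.set0 x = setT.
Proof.
apply/seteqP; split=> // p _; have [w <-] := torus_proj_surj p.
by exists w => // i; rewrite finset.in_set0.
Qed.

(** Half of a lattice vector on which the [i]-th form takes the value 1 leads from [x] to a point
    off [H i]. *)
Lemma cell_neqT S x i : i \in S -> S \subset act x -> cell S x <> setT.
Proof.
move=> iS Sx e; have [z hz] := Aprim i.
have : cell S x (proj (x + 2^-1 *: lat z)) by rewrite e.
move=> /mem_cell[z' /cellC_act/(_ iS)].
rewrite (fintype.subsetP Sx) // act_lat inE evD lfZ lf_lat hz mulr1.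
have xi : ev x i \is a Num.int by have := fintype.subsetP Sx _ iS; rewrite inE.
rewrite rpredDl // => h.
have : code (2^-1 : R) = 1 by have := @code_half R 1; rewrite mul1r.
by move=> e1; move: h; rewrite -dvdz_code e1.
Qed.

(** The flats containing the face of [x] form the interval from the torus to [X], the smallest of
    them as a set. The Möbius sum over it vanishes unless [X] is the torus, that is, unless [x] lies
    on no hyperplane. *)
Lemma mobius_cell_sum x :
  \sum_(Y <- P | `[< cell [set: 'I_m]%SET x `<=` Y >]) mobius P setT Y =
  (act x == finset.set0)%:Z.
Proof.
set X : (set (torus R n))^d := cell (act x) x.
have XP : X \in P.
  by rewrite mem_poset; apply/asboolP/flatsP; right; exists (act x), x.
transitivity
  (\sum_(Y <- P | ((setT : (set (torus R n))^d) <= Y)%O && (Y <= X)%O)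
    mobius P setT Y).
  rewrite big_seq_cond [RHS]big_seq_cond; apply: eq_bigl => Y.
  case: (boolP (Y \in P)) => //=; rewrite mem_poset => /asboolP YP.
  rewrite !dual_le; have -> /= : `[< Y `<=` [set: torus R n] >] by apply/asboolP.
  apply/asboolP/asboolP => h; last first.
    by apply: subset_trans h; apply: cellS; exact: finset.subsetT.
  have hx := h _ (cell_refl A b _ x).
  case/flatsP: YP => [e|[S [w [Sw e]]]]; first by rewrite e in hx.
  rewrite e in hx *; have [z hz] := (mem_cell A b S w x).1 hx.
  rewrite -(cellC_cell_eq hz) cell_lat; apply: cellS.
  apply/fintype.subsetP => i iS; rewrite -(act_lat A b x z) (cellC_act hz iS).
  exact: (fintype.subsetP Sw).
have [ax|/finset.set0Pn[i ia]] := eqVneq.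
  have XT : X = setT by rewrite /X ax cell_set0.
  rewrite XT in XP *; rewrite -big_filter.
  rewrite (perm_big [:: (setT : (set (torus R n))^d)]) ?big_seq1 ?mobius_refl //.
  apply: uniq_perm => //; first by rewrite filter_uniq // fset_uniq.
  move=> Y; rewrite mem_filter inE -eq_le eq_sym.
  by case: eqP => // ->; rewrite XP.
apply: mobius_sum => //; rewrite dual_lt; apply/andP; split; last exact/asboolP.
by apply/eqP => e; apply: (cell_neqT ia (subxx _)); rewrite -/X -e.
Qed.

Lemma spanning_inj I v :
  spanning I -> (forall i, i \in I -> lf v i = 0) -> v = 0.
Proof.
move=> sI h; have : (spanmx I <= kermx v^T)%MS.
  apply/sumsmx_subP => i iI; rewrite genmxE; apply/sub_kermxP.
  by rewrite row_lf h // raddf0.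
move=> h'; have : (1%:M <= kermx v^T)%MS.
  by apply: submx_trans h'; rewrite sub1mx.
by move=> /sub_kermxP; rewrite mul1mx => /(congr1 trmx); rewrite trmxK trmx0.
Qed.

Lemma cell_point S x : S \subset act x -> spanning S -> cell S x = [set proj x].
Proof.
move=> Sx sS; apply/seteqP; split=> [_ [w h <-] /=|_ ->]; last exact: cell_refl.
congr proj; apply/eqP; rewrite -subr_eq0; apply/eqP.
apply: (spanning_inj sS) => i iS; rewrite lfB.
have := fintype.subsetP Sx i iS; rewrite inE => xi.
have := code_int_inj xi (esym (h i iS)); rewrite !evE; lra.
Qed.

Lemma toric_dim_point x k : has_toric_dim [set proj x] k -> k = 0%N.
Proof.
case: k => // k [p [V [Vf e]]]; exfalso.
have hp (u : 'rV[R]_k.+1) : proj (p + u *m V) = proj x.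
  have : (proj @` [set x | exists u : 'rV[R]_k.+1, x = p + u *m V])
      (proj (p + u *m V)).
    by exists (p + u *m V) => //; exists u.
  by rewrite -e.
have [j hj] : exists j, V ord0 j != 0.
  apply: contrapT => hV; have : delta_mx ord0 ord0 *m V = 0 :> 'rV[R]_n.
    apply/rowP => j; rewrite -rowE !mxE; apply: contrapT => h; apply: hV.
    by exists j; apply/eqP.
  move/eqP; rewrite mulmx_free_eq0 // => /eqP/matrixP/(_ ord0 ord0).
  by rewrite !mxE !eqxx => /eqP; rewrite oner_eq0.
(* The scaling moves the [j]-th coordinate by exactly 1/2, which no lattice vector does. *)
have := hp ((2 * V ord0 j)^-1 *: delta_mx ord0 ord0); rewrite -(hp 0).
move=> /torus_proj_eq[z] /rowP/(_ j).
rewrite mul0mx addr0 -scalemxAl -rowE !mxE => h.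
have {h} : (z ord0 j)%:~R = - (2^-1 : R).
  have : (2 * V ord0 j)^-1 * V ord0 j = 2^-1 by field.
  move: h; rewrite -addrA => /(congr1 (fun t => t - p ord0 j)); lra.
move=> /(congr1 code); rewrite -[_%:~R]add0r codeDz.
have -> : - 2^-1 = (-1)%:~R / 2 :> R by rewrite intrN; lra.
by rewrite code_half /code floor0 ceil0; lia.
Qed.

Lemma toric_rank_point x : toric_rank [set proj x] = n.
Proof.
rewrite /toric_rank; case: eqP => [e|_].
  by have : [set proj x] (proj x) by []; rewrite e.
(* The default value of [xget] is 0, so both branches give dimension 0. *)
rewrite /toric_dim; case: xgetP => [k _ /toric_dim_point ->|_]; exact: subn0.
Qed.

Context (Tspan : spanning [set: 'I_m]%SET).

(** A spanning [S] cuts out a point, with only the empty set strictly inside. Otherwise a hyperplane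
    with normal outside the span of [S] meets the flat in a smaller nonempty flat. *)
Lemma coatom_spanning S x : S \subset act x ->
  covered_in P (cell S x) set0 = spanning S.
Proof.
move=> Sx.
have P0 : (set0 : set (torus R n)) \in P.
  by rewrite mem_poset; apply/asboolP; left.
have XP : cell S x \in P.
  by rewrite mem_poset; apply/asboolP/flatsP; right; exists S, x.
have X0 I w : cell I w != set0.
  by apply/eqP => e; have := cell_refl A b I w; rewrite e.
rewrite /covered_in XP P0 /= dual_lt X0 /=.
have -> /= : `[< set0 `<=` cell S x >] by apply/asboolP.
apply/allP/idP => [h|sS Y YP].
  apply: contrapT => /negP nS.
  have [j hj] : exists j, ~~ (row j L <= spanmx S)%MS.
    apply: contrapT => nj; case/negP: nS; rewrite spanningE eqn_leq rank_leq_col /=.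
    rewrite -{1}(eqP Tspan); apply: mxrankS; apply/sumsmx_subP => j _.
    by rewrite genmxE; apply: contrapT => /negP hj; apply: nj; exists j.
  have [v [v0 vj]] := spanmx_witness hj.
  (* A point of the flat with [j]-th code [c]: [y 0] lies on [H j] and [y 1] does not. *)
  pose y (c : int) := x + (c%:~R / 2 - ev x j) *: v.
  have yS c : cellC S x (y c) by move=> i iS; rewrite ev_dir0 // v0.
  have yj c : code (ev (y c) j) = c by exact: code_dir.
  have jS : j |: S \subset act (y 0).
    apply/fintype.subsetP => i /setU1P[->|iS]; first by rewrite inE -dvdz_code yj.
    by rewrite (cellC_act (yS 0) iS); exact: (fintype.subsetP Sx).
  have YP : cell (j |: S) (y 0) \in P.
    by rewrite mem_poset; apply/asboolP/flatsP; right; exists (j |: S), (y 0).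
  have := h _ YP; rewrite !dual_lt X0 /=.
  have -> /= : `[< set0 `<=` cell (j |: S) (y 0) >] by apply/asboolP.
  have -> : `[< cell (j |: S) (y 0) `<=` cell S x >].
    apply/asboolP; rewrite -(cellC_cell_eq (yS 0)); apply: cellS.
    exact: finset.subsetUr.
  rewrite !andbT negbK => /eqP e.
  have : cell S x (proj (y 1)).
    by rewrite -(cellC_cell_eq (yS 1)); exact: cell_refl.
  rewrite e => /mem_cell[z /cellC_act/(_ (setU11 j S))].
  by rewrite act_lat !inE -!dvdz_code !yj.
rewrite (cell_point Sx sS) !dual_lt; apply/negP.
move=> /andP[/andP[nX /asboolP h] /andP[/eqP n0 _]].
case/negP: nX; apply/eqP; apply/seteqP; split=> // _ ->.
have /set0P[p Yp] : Y != set0 by apply/eqP.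
by have /= <- := h _ Yp.
Qed.

Lemma region_count : (#|` fset_set (regions H) |)%:Z = Zt H.
Proof.
set T := [set: 'I_m]%SET.
(* The inner Möbius sum is the indicator of regions, whose sign is 1. *)
transitivity (\sum_(F <- fset_set (cells T)) cell_sign T F *
    \sum_(Y <- P | `[< F `<=` Y >]) mobius P setT Y).
  have -> : (#|` fset_set (regions H)|)%:Z = \sum_(F <- fset_set (regions H)) 1.
    by rewrite big_const_seq count_predT iter_addr_0 natz.
  rewrite (perm_big [seq F <- fset_set (cells T) | F \in fset_set (regions H)]).
    rewrite big_filter big_mkcond big_seq [RHS]big_seq; apply: eq_bigr => F.
    move=> /cellsP[x ->]; rewrite mobius_cell_sum cell_signE.
    rewrite in_fset_set; last exact: regions_finite.
    have [ax|ax] := eqVneq.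
      rewrite ax finset.set0I rk_set0 expr0 mulr1.
      by rewrite mem_set //; apply/regionsP; exists x.
    rewrite mulr0 memNset // => /regionsP[w [aw e]].
    have := cell_actI e; rewrite aw !finset.setIT => h.
    by rewrite h eqxx in ax.
  apply: uniq_perm; [exact: fset_uniq|by rewrite filter_uniq // fset_uniq|].
  move=> F; rewrite mem_filter; case: (boolP (F \in _)) => //=.
  rewrite in_fset_set; last exact: regions_finite.
  by rewrite inE => /regionsP[x [_ ->]]; rewrite mem_cells.
transitivity (\sum_(Y <- P) mobius P setT Y * euler_sum T Y).
  under eq_bigr do rewrite mulr_sumr big_mkcond.
  rewrite exchange_big /=; apply: eq_bigr => Y _.
  rewrite euler_sumE mulr_sumr [RHS]big_mkcond; apply: eq_bigr => F _.
  by case: ifP => // _; rewrite mulrC.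
(* Termwise comparison: the empty flat contains no face, a coatom is a point of rank [n] with Euler
   sum [(-1)^n], and every other flat has Euler sum 0. *)
rewrite /Zt [RHS]big_mkcond big_seq [RHS]big_seq; apply: eq_bigr => Y.
rewrite mem_poset => /asboolP/flatsP[->|[S [x [Sx ->]]]].
  rewrite /covered_in ltxx !andbF euler_sumE big_seq_cond big1 ?mulr0 //.
  move=> F /andP[/cellsP[x ->] /asboolP h].
  by have := h _ (cell_refl A b T x).
rewrite coatom_spanning //; case: ifP => sS.
  rewrite (euler_sum_spanning Sx sS) ?finset.subsetT // cell_point //.
  by rewrite toric_rank_point mulrC.
by rewrite euler_sum_nonspanning ?sS ?finset.subsetT // mulr0.
Qed.

End Counting.

(** * Integral normal forms *)

Section Integrality.
Context {n : nat}.

Lemma clear_denominators (a : 'rV[rat]_n) : exists (d : int) (l : 'rV[int]_n),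
  d != 0 /\ d%:~R *: a = map_mx intr l.
Proof.
exists (\prod_j denq (a ord0 j)).
exists (\row_i (numq (a ord0 i) * \prod_(j | j != i) denq (a ord0 j))); split.
  by apply/prodf_neq0 => j _; exact: denq_neq0.
apply/rowP => i; rewrite !mxE (bigD1 i) //= !intrM mulrAC.
rewrite -{2}[a ord0 i]divq_num_den.
by congr (_ * _); rewrite mulrC divfK // intr_eq0 denq_neq0.
Qed.

(** Bézout's argument: [g] is the least positive value of [l] on the lattice, attained at [z]. A
    nonzero remainder of a coordinate modulo [g] would be a smaller positive value. *)
Lemma primitive_row (l : 'rV[int]_n) : l != 0 ->
  exists (g : int) (l' z : 'rV[int]_n),
  [/\ g != 0, l = g *: l' & (l' *m z^T) ord0 ord0 = 1].
Proof.
move=> l0.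
pose P (k : nat) : bool :=
  `[< (0 < k)%N /\ exists z : 'rV[int]_n, (l *m z^T) ord0 ord0 = k%:Z >].
have exP : exists k, P k.
  pose s := (l *m l^T) ord0 ord0.
  have s0 : 0 < s.
    have [j lj] : exists j, l ord0 j != 0.
      apply: contrapT => h; case/negP: l0; apply/eqP/rowP => j; rewrite mxE.
      by apply: contrapT => lj; apply: h; exists j; apply/eqP.
    rewrite /s mxE (bigD1 j) //= mxE ltr_pwDl //.
      by rewrite -expr2 lt_neqAle sqr_ge0 eq_sym sqrf_eq0 lj.
    by apply: sumr_ge0 => i _; rewrite mxE -expr2 sqr_ge0.
  exists (absz s); apply/asboolP; split; first by lia.
  by exists l; rewrite gez0_abs // ltW.
case: (ex_minnP exP) => g /asboolP[g0 [z hz]] gmin.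
have dvd j : (g%:Z %| l ord0 j)%Z.
  apply: contrapT => nd.
  have e : (l *m (delta_mx ord0 j - (l ord0 j %/ g%:Z)%Z *: z)^T) ord0 ord0 =
      (l ord0 j %% g%:Z)%Z.
    rewrite linearB linearZ /= mulmxBr -scalemxAr trmx_delta -colE.
    rewrite [LHS]mxE [X in X + _]mxE [X in _ + X]mxE [X in _ - X]mxE.
    by rewrite hz /modz.
  have r0 : (l ord0 j %% g%:Z)%Z != 0.
    by apply: contra_notN nd => /eqP/dvdz_mod0P.
  have rg : 0 <= (l ord0 j %% g%:Z)%Z < g%:Z.
    by rewrite modz_ge0 ?ltz_pmod //; lia.
  suff /gmin : P (absz (l ord0 j %% g%:Z)%Z) by lia.
  apply/asboolP; split; first by lia.
  by exists (delta_mx ord0 j - (l ord0 j %/ g%:Z)%Z *: z); rewrite e; lia.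
pose l' : 'rV[int]_n := \row_j (l ord0 j %/ g%:Z)%Z.
have eg : l = g%:Z *: l' by apply/rowP => j; rewrite !mxE mulrC divzK.
have g0' : g%:Z != 0 by lia.
exists g%:Z, l', z; split=> //; apply: (mulfI g0').
by rewrite mulr1 -[RHS]hz eg -scalemxAl [RHS]mxE.
Qed.

(** With [l] primitive, all level sets of [l] at integer distance from [b] are lattice translates of
    one of them, by multiples of [z], so they have the same image. *)
Lemma toric_hyperplane_normal (R : realType) (X : set (torus R n)) :
  toric_hyperplane X -> exists (l z : 'rV[int]_n) (b : R),
    (l *m z^T) ord0 ord0 = 1 /\
    X = @torus_proj R n @`
      [set x : 'rV[R]_n | \sum_j (l ord0 j)%:~R * x ord0 j - b \is a Num.int].
Proof.
move=> [a [b0 [a0 ->]]].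
have [d [l0 [d0 e0]]] := clear_denominators a.
have dq : d%:~R != 0 :> rat by rewrite intr_eq0.
have l00 : l0 != 0.
  apply: contraNneq a0 => l00; move: e0; rewrite l00 map_mx0 => /eqP.
  by rewrite scaler_eq0 (negPf dq).
have [g [l [z [g0 el hz]]]] := primitive_row l00.
pose c : rat := g%:~R / d%:~R.
have c0 : ratr c != 0 :> R by rewrite fmorph_eq0 mulf_neq0 ?invr_eq0 ?intr_eq0.
have ea j : ratr (a ord0 j) = ratr c * (l ord0 j)%:~R :> R.
  rewrite -[(l ord0 j)%:~R]ratr_int -rmorphM; congr ratr.
  move/rowP/(_ j): e0; rewrite el !mxE intrM /c => h.
  by rewrite mulrAC -h mulrC mulKf.
have sumE (x : 'rV[R]_n) : \sum_j ratr (a ord0 j) * x ord0 j =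
    ratr c * \sum_j (l ord0 j)%:~R * x ord0 j.
  by rewrite mulr_sumr; apply: eq_bigr => j _; rewrite ea mulrA.
exists l, z, (b0 / ratr c); split=> //.
apply/seteqP; split=> _ [x /= h <-].
  by exists x => //=; rewrite -h sumE mulrC mulrA mulVf // mul1r subrr rpred0.
exists (x + lat
    (- (Num.floor (\sum_j (l ord0 j)%:~R * x ord0 j - b0 / ratr c)) *: z));
  last by rewrite torus_proj_lat.
set k := Num.floor _ in h *; have ek := floorK h; rewrite -/k in ek.
rewrite sumE (_ : \sum_j _ = \sum_j (l ord0 j)%:~R * x ord0 j - k%:~R).
  by rewrite ek; field.
under eq_bigr do rewrite !mxE mulrDr.
rewrite big_split /=; congr (_ + _).
have -> : - k%:~R = (- k * (l *m z^T) ord0 ord0)%:~R :> R.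
  by rewrite hz mulr1 intrN.
rewrite mxE mulr_sumr rmorph_sum; apply: eq_bigr => j _.
by rewrite mxE -intrM; congr _%:~R; ring.
Qed.

End Integrality.

(** The rank of an integral matrix is the same over the rationals and over [R]; a rational kernel
    vector is then cleared of denominators. *)
Lemma nonspanning_kernel (R : realType) (n m : nat) (A : 'M[int]_(m, n)) :
  ~~ spanning (R := R) A [set: 'I_m]%SET ->
  exists2 v : 'rV[int]_n, v != 0 & A *m v^T = 0.
Proof.
move=> ns; pose Aq : 'M[rat]_(m, n) := map_mx intr A.
have rA : (\rank Aq < n)%N.
  rewrite -(mxrank_map (@ratr R)); apply: contraR ns.
  rewrite -leqNgt spanningE => h.
  rewrite eqn_leq rank_leq_col /=; apply: leq_trans h _; apply: mxrankS.
  apply/row_subP => i.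
  have -> : row i (map_mx ratr Aq) = row i (realmx A) :> 'rV[R]_n.
    by apply/rowP => j; rewrite !mxE ratr_int.
  exact: row_spanmx.
have : kermx Aq^T != 0.
  by rewrite -mxrank_eq0 mxrank_ker mxrank_tr -lt0n subn_gt0.
move=> /rowV0Pn[u /sub_kermxP hu u0].
have [d [v [d0 e]]] := clear_denominators u.
have dq : d%:~R != 0 :> rat by rewrite intr_eq0.
exists v.
  apply: contraNneq u0 => v0; move: e; rewrite v0 map_mx0 => /eqP.
  by rewrite scaler_eq0 (negPf dq).
apply/trmx_inj; rewrite trmx_mul trmxK trmx0; apply/matrixP => i j.
apply/eqP; rewrite [X in _ == X]mxE -(intr_eq0 rat) mxE rmorph_sum /=.
have /matrixP/(_ i j) : (map_mx intr v : 'rV[rat]_n) *m Aq^T = 0.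
  by rewrite -e -scalemxAl hu scaler0.
rewrite !mxE => h; apply/eqP; rewrite -[RHS]h.
by apply: eq_bigr => k _; rewrite !mxE intrM.
Qed.

(** * Loops in an open cell are contractible *)

Section NearestInt.
Context {R : realType}.
Implicit Types r e : R.

(** The signed distance to a nearest integer, with values in [[-1/2, 1/2)]. *)
Definition sawtooth r : R := r - (Num.floor (r + 2^-1))%:~R.

Lemma sawtoothDz r (c : int) : sawtooth (r + c%:~R) = sawtooth r.
Proof.
rewrite /sawtooth.
have -> : Num.floor (r + c%:~R + 2^-1) = Num.floor (r + 2^-1) + c.
  by rewrite addrAC floorDrz ?intr_int // intrKfloor.
by rewrite intrD opprD addrACA subrr addr0.
Qed.

Lemma sawtooth0 : sawtooth 0 = 0.
Proof.
rewrite /sawtooth (_ : Num.floor _ = 0) ?subrr //.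
by apply: floor_def; rewrite add0r; apply/andP; split; lra.
Qed.

Lemma sawtooth_ltP r e : e <= 2^-1 ->
  `|sawtooth r| < e <-> exists c : int, `|r - c%:~R| < e.
Proof.
move=> e2; split=> [h|[c]]; first by exists (Num.floor (r + 2^-1)).
rewrite ltr_norml => /andP[h1 h2].
suff h : Num.floor (r + 2^-1) = c by rewrite /sawtooth h ltr_norml h1 h2.
by apply: floor_def; rewrite intrD; apply/andP; split; lra.
Qed.

(** [sawtooth] jumps at the half-integers, but for these [e] the set is a union of balls centred at
    integers. *)
Lemma open_sawtooth e : e <= 2^-1 -> open [set r | `|sawtooth r| < e].
Proof.
move=> e2; have -> : [set r | `|sawtooth r| < e] =
    \bigcup_(c in [set: int]) ball (c%:~R : R) e.
  apply/seteqP; split=> r /=.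
    move=> /(sawtooth_ltP _ e2)[c h]; exists c => //.
    by rewrite -ball_normE /= distrC.
  move=> [c _]; rewrite -ball_normE /= distrC => h.
  by apply/(sawtooth_ltP _ e2); exists c.
by apply: bigcup_open => c _; exact: ball_open.
Qed.

End NearestInt.

(** * Winding numbers of loops in the torus *)

Section Winding.
Context {R : realType} {n : nat}.
Local Notation proj := (@torus_proj R n).
Implicit Types (p q : torus R n) (x : 'rV[R]_n).

Definition tdiff (k : 'I_n) p q : R :=
  sawtooth ((repr p : 'rV[R]_n) ord0 k - (repr q : 'rV[R]_n) ord0 k).

Lemma proj_repr p : proj (repr p) = p.
Proof. by rewrite /torus_proj reprK. Qed.

Lemma tdiff_proj k x w :
  tdiff k (proj x) (proj w) = sawtooth (x ord0 k - w ord0 k).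
Proof.
rewrite /tdiff.
have [z ->] := (torus_proj_eq _ _).1 (esym (proj_repr (proj x))).
have [z' ->] := (torus_proj_eq _ _).1 (esym (proj_repr (proj w))).
rewrite -[RHS](sawtoothDz _ (z ord0 k - z' ord0 k)) !mxE intrB.
by congr sawtooth; ring.
Qed.

Lemma tdiff_int k p q : exists c : int,
  tdiff k p q = (repr p : 'rV[R]_n) ord0 k - (repr q : 'rV[R]_n) ord0 k - c%:~R.
Proof. by eexists; reflexivity. Qed.

Lemma tdiff_refl k p : tdiff k p p = 0.
Proof. by rewrite /tdiff subrr sawtooth0. Qed.

(** With 1/8 here, two points near [p] differ by less than 1/4, and four such differences around a
    grid square total less than 1. *)
Lemma tdiff_near k p : nbhs p [set q | `|tdiff k q p| < 8^-1].
Proof.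
apply: open_nbhs_nbhs; split; last by rewrite /= tdiff_refl normr0; lra.
rewrite /open/= /quotient_open.
have [x <-] := torus_proj_surj p.
have -> : \pi_(torus R n)%qT @^-1` [set q | `|tdiff k q (proj x)| < 8^-1] =
    (fun w : 'rV[R]_n => w ord0 k - x ord0 k)
      @^-1` [set r | `|sawtooth r| < 8^-1].
  by apply/seteqP; split=> w /=; rewrite (tdiff_proj k w x).
apply: open_comp; last by apply: open_sawtooth; lra.
move=> w _; apply: (@cvgB _ _ _ (nbhs (w : 'rV[R]_n))); last exact: cvg_cst.
exact: coord_continuous.
Qed.

Lemma tdiff_tri k p q q' : `|tdiff k q p| < 8^-1 -> `|tdiff k q' p| < 8^-1 ->
  `|tdiff k q q'| < 4^-1.
Proof.
have h8 : 8^-1 <= 2^-1 :> R by lra.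
move=> /(sawtooth_ltP _ h8)[c hc] /(sawtooth_ltP _ h8)[c' hc'].
apply/sawtooth_ltP; first by lra.
exists (c - c'); rewrite intrB; move: hc hc'; rewrite !ltr_norml.
by move=> /andP[? ?] /andP[? ?]; apply/andP; split; lra.
Qed.

(* The sum around a small square is an integer of absolute value less than 1. *)
Lemma tdiff_square k p q p' q' :
  `|tdiff k q p| < 4^-1 -> `|tdiff k q' q| < 4^-1 ->
  `|tdiff k p' p| < 4^-1 -> `|tdiff k q' p'| < 4^-1 ->
  tdiff k q p + tdiff k q' q = tdiff k p' p + tdiff k q' p'.
Proof.
have [c1 e1] := tdiff_int k q p; have [c2 e2] := tdiff_int k q' q.
have [c3 e3] := tdiff_int k p' p; have [c4 e4] := tdiff_int k q' p'.
rewrite !ltr_norml => /andP[? ?] /andP[? ?] /andP[? ?] /andP[? ?].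
apply/eqP; rewrite -subr_eq0.
have e : tdiff k q p + tdiff k q' q - (tdiff k p' p + tdiff k q' p') =
    (c3 + c4 - c1 - c2)%:~R by rewrite e1 e2 e3 e4 !intrB intrD; ring.
rewrite e intr_eq0.
set c := c3 + c4 - c1 - c2 in e *.
have l1 : (-1)%:~R < c%:~R :> R by rewrite -e intrN; lra.
have l2 : c%:~R < 1%:~R :> R by rewrite -e; lra.
by rewrite !ltr_int in l1 l2; lia.
Qed.

Definition unit_square : set (R * R) := `[0, 1] `*` `[0, 1].

(** A Lebesgue number argument, through the near-covering form of compactness. *)
Lemma square_mesh (G : R * R -> torus R n) k :
  (forall u : R * R, unit_square u -> {for u, continuous G}) ->
  \forall N \near \oo, forall u u' : R * R, unit_square u ->
    `|u.1 - u'.1| <= N.+1%:R^-1 -> `|u.2 - u'.2| <= N.+1%:R^-1 ->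
    `|tdiff k (G u') (G u)| < 4^-1.
Proof.
move=> Gc.
have cK : compact unit_square.
  by apply: compact_setX; exact: segment_compact.
have /(_ nat \oo (fun N (u : R * R) => forall u' : R * R,
    `|u.1 - u'.1| <= N.+1%:R^-1 -> `|u.2 - u'.2| <= N.+1%:R^-1 ->
    `|tdiff k (G u') (G u)| < 4^-1)) := (compact_near_coveringP _).1 cK.
have step (u : R * R) : unit_square u ->
  \forall u' \near u & N \near \oo, forall u'' : R * R,
    `|u'.1 - u''.1| <= N.+1%:R^-1 -> `|u'.2 - u''.2| <= N.+1%:R^-1 ->
    `|tdiff k (G u'') (G u')| < 4^-1.
  move=> Ku; have /nbhs_ballP[e /= e0 he] := Gc u Ku _ (tdiff_near k (G u)).
  exists (ball u (e / 2), [set N | (N.+1%:R^-1 < e / 2 :> R)]) => /=.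
    split; first by apply: nbhsx_ballx; rewrite divr_gt0.
    exact: (near_infty_natSinv_lt (PosNum (divr_gt0 e0 (ltr0n R 2)))).
  move=> [u' N] /= [[b1 b2] hN] u'' h1 h2; rewrite /ball/= in b1 b2.
  have inball (r r' : R) : `|r - r'| < e -> ball r e r' by rewrite -ball_normE.
  have hr (r r' r'' : R) : ball r (e / 2) r' -> `|r' - r''| <= N.+1%:R^-1 ->
      ball r e r''.
    rewrite -ball_normE /= => h h'; apply: inball.
    rewrite -(subrK r' r) -addrA; apply: le_lt_trans (ler_normD _ _) _.
    by rewrite [ltRHS]splitr; apply: ltrD => //; exact: le_lt_trans h' hN.
  apply: (@tdiff_tri k (G u)); apply: he; split;
    [exact: hr b1 h1|exact: hr b2 h2| |].
    by apply: (hr _ _ _ b1); rewrite subrr normr0 invr_ge0.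
  by apply: (hr _ _ _ b2); rewrite subrr normr0 invr_ge0.
move=> h; apply: (@filterS _ \oo _ _ _ _ (h _ step)) => N hN u u' Ku.
exact: hN.
Qed.

(** The sum [W i] of the small differences along column [i] is a discrete winding number. It does
    not depend on [i], vanishes on the constant last column, and on the first column is governed by
    [v ord0 k]. *)
Lemma contractible_loop (G : R * R -> torus R n) (q : torus R n) x
    (v : 'rV[int]_n) :
  (forall u : R * R, unit_square u -> {for u, continuous G}) ->
  (forall s : R, 0 <= s <= 1 -> G (s, 0) = q /\ G (s, 1) = q) ->
  (forall t : R, 0 <= t <= 1 -> G (1, t) = q) ->
  (forall t : R, 0 <= t <= 1 -> G (0, t) = proj (x + t *: lat v)) ->
  v = 0.
Proof.
move=> Gc Gs G1 G0; apply/rowP => k; rewrite mxE.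
have [N [hN vN]] := @filter_ex _ \oo _ _
  (filterI (square_mesh k Gc) (nbhs_infty_ge (absz (v ord0 k)))).
rewrite /= in vN.
pose r (i : nat) : R := i%:R / N.+1%:R.
have r01 i : (i <= N.+1)%N -> 0 <= r i <= 1.
  by move=> iN; rewrite divr_ge0 //= ler_pdivrMr // mul1r ler_nat.
have rS i : r i.+1 = r i + N.+1%:R^-1 by rewrite /r -natr1 mulrDl mul1r.
have r0 : r 0%N = 0 by rewrite /r mul0r.
have rM : r N.+1 = 1 by rewrite /r divff.
have Nge0 : 0 <= N.+1%:R^-1 :> R by rewrite invr_ge0.
pose pt i j := G (r i, r j).
have sq i j : (i <= N.+1)%N -> (j <= N.+1)%N -> unit_square (r i, r j).
  by move=> /r01 hi /r01 hj; split; rewrite /= in_itv.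
have near0 (s : R) : `|s - s| <= N.+1%:R^-1 by rewrite subrr normr0.
have nearS i : `|r i - r i.+1| <= N.+1%:R^-1.
  by rewrite rS opprD addNKr normrN ger0_norm.
have dh i j : (i <= N.+1)%N -> (j <= N)%N ->
    `|tdiff k (pt i j.+1) (pt i j)| < 4^-1.
  move=> hi hj; apply: hN; [|exact: near0|exact: nearS].
  by apply: sq => //; exact: leqW.
have dv i j : (i <= N)%N -> (j <= N.+1)%N ->
    `|tdiff k (pt i.+1 j) (pt i j)| < 4^-1.
  move=> hi hj; apply: hN; [|exact: nearS|exact: near0].
  by apply: sq => //; exact: leqW.
pose W i := \sum_(0 <= j < N.+1) tdiff k (pt i j.+1) (pt i j).
(* The square relation is summed up the strip between columns [i] and [i.+1]; the horizontal terms
   at both ends vanish later because the loops share the base point [q]. *)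
have partial i j : (i <= N)%N -> (j <= N.+1)%N ->
    \sum_(0 <= l < j) tdiff k (pt i l.+1) (pt i l) +
    tdiff k (pt i.+1 j) (pt i j) =
    tdiff k (pt i.+1 0%N) (pt i 0%N) +
    \sum_(0 <= l < j) tdiff k (pt i.+1 l.+1) (pt i.+1 l).
  move=> hi; elim: j => [|j IH] hj; first by rewrite !big_geq // add0r addr0.
  rewrite !big_nat_recr //= -addrA.
  rewrite (@tdiff_square k (pt i j) (pt i j.+1) (pt i.+1 j) (pt i.+1 j.+1)).
  - by rewrite addrA IH ?addrA // ltnW.
  - by apply: dh => //; exact: leqW.
  - exact: dv.
  - by apply: dv => //; exact: ltnW.
  - exact: dh.
have side i : (i <= N.+1)%N -> pt i 0%N = q /\ pt i N.+1 = q.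
  by move=> /r01 hi; rewrite /pt r0 rM; exact: Gs.
have WS i : (i <= N)%N -> W i.+1 = W i.
  move=> hi; have := partial i N.+1 hi (leqnn _).
  have [-> ->] := side i (leqW hi); have [-> ->] := side i.+1 hi.
  by rewrite tdiff_refl add0r addr0 /W => ->.
have W0 : W 0%N = W N.+1.
  have h i : (i <= N.+1)%N -> W i = W 0%N.
    by elim: i => // i IH hi; rewrite WS // IH // ltnW.
  by rewrite h.
have WN : W N.+1 = 0.
  rewrite /W big_nat big1 // => j /andP[_ hj]; rewrite /pt rM.
  by rewrite !G1 ?tdiff_refl //; apply: r01 => //; exact: ltnW.
have e : W 0%N = N.+1%:R * sawtooth ((v ord0 k)%:~R / N.+1%:R).
  rewrite /W big_nat (eq_bigr (fun=> sawtooth ((v ord0 k)%:~R / N.+1%:R))).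
    by rewrite -big_nat sumr_const_nat subn0 mulr_natl.
  move=> j /andP[_ hj]; rewrite /pt r0 !G0; [|apply: r01; exact: ltnW|exact: r01].
  by rewrite tdiff_proj !mxE rS; congr sawtooth; ring.
(* So [v ord0 k] is a multiple of [N.+1], and the choice of [N] at least its absolute value leaves
   only 0. *)
have : sawtooth ((v ord0 k)%:~R / N.+1%:R : R) = 0.
  apply/eqP; have := e; rewrite W0 WN => /esym/eqP.
  by rewrite mulf_eq0 pnatr_eq0.
rewrite /sawtooth => /subr0_eq; set c := Num.floor _ => hc.
have {}hc : v ord0 k = c * N.+1%:Z.
  apply/eqP; rewrite -(eqr_int R) intrM -hc divfK //.
have [c0|c0] := eqVneq c 0; first by rewrite hc c0 mul0r.
have : (N.+1 <= absz (v ord0 k))%N by rewrite hc abszM leq_pmull // absz_gt0.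
by rewrite ltnNge vN.
Qed.

Lemma open_unit_ball_open : open (@open_unit_ball R n).
Proof.
have c : continuous (fun x : 'rV[R]_n => \sum_i x ord0 i ^+ 2).
  suff h (s : seq 'I_n) (x : 'rV[R]_n) : \sum_(j <- s) w ord0 j ^+ 2
      @[w --> x] --> \sum_(j <- s) x ord0 j ^+ 2 by move=> x; exact: h.
  elim: s => [|j s IH].
    by under eq_fun do rewrite big_nil; rewrite big_nil; exact: cvg_cst.
  under eq_fun do rewrite big_cons; rewrite big_cons.
  apply: cvgD; last exact: IH.
  under eq_fun do rewrite expr2; rewrite expr2.
  by apply: cvgM; exact: coord_continuous.
have -> : @open_unit_ball R n =
    (fun x : 'rV[R]_n => \sum_i x ord0 i ^+ 2) @^-1` [set r | r < 1] by [].
by apply: open_comp; [move=> x _; exact: c|exact: open_lt].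
Qed.

Lemma open_unit_ball_convex x w (s : R) :
  open_unit_ball x -> open_unit_ball w ->
  0 <= s <= 1 -> open_unit_ball (x + s *: (w - x)).
Proof.
rewrite /open_unit_ball /= => hx hw /andP[s0 s1].
apply: (@le_lt_trans _ _
  (\sum_i ((1 - s) * x ord0 i ^+ 2 + s * w ord0 i ^+ 2))).
  apply: ler_sum => i _; rewrite !mxE -subr_ge0.
  have -> : (1 - s) * x ord0 i ^+ 2 + s * w ord0 i ^+ 2 -
    (x ord0 i + s * (w ord0 i - x ord0 i)) ^+ 2 =
    s * (1 - s) * (x ord0 i - w ord0 i) ^+ 2 by ring.
  by rewrite mulr_ge0 ?sqr_ge0 // mulr_ge0 // subr_ge0.
rewrite big_split /= -!mulr_sumr.
set a := \sum_i _ in hx *; set c := \sum_i _ in hw *.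
apply: (@le_lt_trans _ _ (Num.max a c)); last by rewrite gt_max hx hw.
have ha : a <= Num.max a c by rewrite le_max lexx.
have hc : c <= Num.max a c by rewrite le_max lexx orbT.
have s1' : 0 <= 1 - s by rewrite subr_ge0.
by have := lerD (ler_wpM2l s1' ha) (ler_wpM2l s0 hc); lra.
Qed.

(** The loop is carried to the ball by [f], contracted there along straight segments to its base
    point, and carried back by [g]. *)
Lemma open_cell_no_loop (X : set (torus R n)) x (v : 'rV[int]_n) :
  open_cell X -> (forall t : R, X (proj (x + t *: lat v))) -> v = 0.
Proof.
move=> [f [g [fc gc fX gX [fK gK]]]] hX.
pose loop (t : R) := proj (x + t *: lat v).
have loopc : continuous loop.
  move=> t; apply: (@continuous_comp _ _ _ (fun t : R => x + t *: lat v) proj).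
    exact: line_continuous.
  exact: torus_proj_continuous.
pose gam (t : R) : 'rV[R]_n := f (loop t).
have gamB t : open_unit_ball (gam t).
  by apply: fX; exists (loop t) => //; exact: hX.
have gamc : continuous gam.
  move=> t U hU; have := (subspace_continuousP X f).1 fc _ (hX t) _ hU.
  move=> /loopc h; apply: (@filterS _ (nbhs (t : R)) _ _ _ _ h) => t' /= h'.
  by apply: h'; exact: hX.
have loop1 : loop 1 = loop 0.
  by rewrite /loop scale1r scale0r addr0 torus_proj_lat.
pose G (u : R * R) := g (gam u.2 + u.1 *: (gam 0 - gam u.2)).
have gfK t : g (gam t) = loop t by rewrite /gam fK // inE; exact: hX.
apply: (@contractible_loop G (loop 0) x v).
- move=> [s t] [/= hs ht]; rewrite in_itv /= in hs.
  apply: (@continuous_comp _ _ _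
    (fun u : R * R => gam u.2 + u.1 *: (gam 0 - gam u.2)) g); last first.
    have hB := open_unit_ball_convex (gamB t) (gamB 0) hs.
    have := gc; rewrite (continuous_open_subspace _ open_unit_ball_open).
    by apply; rewrite inE.
  have c2 : gam u.2 @[u --> (s, t)] --> gam t.
    apply: (@cvg_comp _ _ _ snd gam _ (nbhs t)); [exact: cvg_snd|exact: gamc].
  apply: cvgD => //; apply: cvgZ; first exact: cvg_fst.
  by apply: cvgB => //; exact: cvg_cst.
- move=> s _; rewrite /G /= subrr scaler0 addr0 gfK; split=> //.
  by rewrite /gam loop1 subrr scaler0 addr0 -loop1 -/(gam 1) gfK.
- by move=> t _; rewrite /G /= scale1r addrC subrK gfK.
- by move=> t _; rewrite /G /= scale0r addr0 gfK.
Qed.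

End Winding.

(** * Cellular arrangements are essential *)

Section Essential.
Context {R : realType} {n m : nat} (A : 'M[int]_(m, n)) (b : 'I_m -> R).
Context (H : 'I_m -> set (torus R n)).
Context (HE : forall i,
  H i = @torus_proj R n @` [set x | ev A b x i \is a Num.int]).
Context (Aprim : forall i, exists z : 'rV[int]_n, (A *m z^T) i ord0 = 1).

(** A small move along a vector on which the [i]-th form is 1 leaves [H i] and meets no new
    hyperplane, so the number of hyperplanes through the point drops. *)
Lemma generic_point : exists x, act A b x = finset.set0.
Proof.
suff h k x : (#|act A b x| < k)%N -> exists x, act A b x = finset.set0.
  by apply: (h #|act A b 0|.+1 0).
elim: k x => // k IH x; rewrite ltnS => hk.
have [|/finset.set0Pn[i ia]] := eqVneq (act A b x) finset.set0.
  by exists x.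
have [z hz] := Aprim i.
have [e e0 he] := cellC_perturb A b x (lat z).
pose t := Num.min (e / 2) 2^-1.
have t0 : 0 < t by rewrite lt_min divr_gt0 //= invr_gt0.
have te : `|t| < e.
  rewrite gtr0_norm //; apply: (@le_lt_trans _ _ (e / 2)); last by lra.
  by rewrite ge_min lexx.
have xi : ev A b x i \is a Num.int by rewrite inE in ia.
have ti : ev A b (x + t *: lat z) i \isn't a Num.int.
  rewrite -dvdz_code (star_right xi (he t te i)); last first.
    by rewrite evD lfZ lf_lat hz mulr1 ltrDl.
  by have := xi; rewrite -dvdz_code; lia.
apply: (IH (x + t *: lat z)); apply: leq_trans hk; apply: proper_card.
apply/fintype.properP; split; last first.
  by exists i => //; rewrite inE.
apply/fintype.subsetP => j; apply: contraLR; rewrite !inE => xj.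
by rewrite -dvdz_code (star_odd xj (he t te j)) dvdz_code.
Qed.

Lemma cells_spanning : (forall X, regions H X -> open_cell X) ->
  spanning (R := R) A [set: 'I_m]%SET.
Proof.
move=> Hc; apply: contrapT => /negP/nonspanning_kernel[v v0 Av].
have [x ax] := generic_point.
case/eqP: v0; apply: (@open_cell_no_loop R n (cell A b [set: 'I_m]%SET x) x).
  by apply: Hc; apply/(regionsP HE); exists x.
move=> t; exists (x + t *: lat v) => // i _.
by rewrite evD lfZ lf_lat Av mxE mulr0 addr0.
Qed.

End Essential.

Theorem theorem3p11 (R : realType) (n m : nat) (H : 'I_m -> set (torus R n))
  (H_hyperplane : forall i, toric_hyperplane (H i))
  (H_cells : forall X : set (torus R n), regions H X -> open_cell X) :
  finite_set (regions H) /\ (#|` fset_set (regions H) |)%:Z = Zt H.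
Proof.
have [l hl] := choice (fun i => toric_hyperplane_normal (H_hyperplane i)).
have [z hz] := choice hl; have [b hb] := choice hz.
pose A : 'M[int]_(m, n) := \matrix_(i, j) l i ord0 j.
have HE i : H i = @torus_proj R n @` [set x | ev A b x i \is a Num.int].
  rewrite (hb i).2; congr (_ @` _); apply/funext => x /=.
  by rewrite evE lfE; under [in RHS]eq_bigr do rewrite mxE.
have Aprim i : exists z : 'rV[int]_n, (A *m z^T) i ord0 = 1.
  exists (z i); rewrite -[RHS](hb i).1 !mxE.
  by apply: eq_bigr => j _; rewrite mxE.
have Tspan := cells_spanning HE Aprim H_cells.
split; first exact: regions_finite HE.
exact: region_count HE Aprim Tspan.
Qed.
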